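(* Let $(\mathcal M,g)$ be the Bardeen spacetime with parameters $M\ne 0$, $e\neq 0$, with coordinates $(t,\rho,\theta,\phi)$ and $\rho_1=(e^2+\rho^2)^{1/2}$, and let $T=S-\frac{\kappa}{2}g+\Lambda g$ be its energy momentum tensor, where $\Lambda$ is a constant. Then: (i) $R\cdot T=-\dfrac{M(2\rho_1^2-3\rho^2)}{\rho_1^5}\,Q(g,T)$, i.e. the energy momentum tensor is pseudosymmetric; (ii) $C\cdot T=-\dfrac{M\rho^2(3\rho_1^2-5\rho^2)}{2\rho_1^7}\,Q(g,T)$, i.e. the energy momentum tensor is pseudosymmetric due to the Weyl tensor; (iii) $T$ is Riemann compatible and Weyl compatible: for $D\in\{R,C\}$ and all vector fields, $\sum_{\mathrm{cyc}(\zeta_1,\zeta_2,\zeta_3)}D(\mathscr T\zeta_1,X,\zeta_2,\zeta_3)=0$, where $\mathscr T$ is the endomorphism with $g(\mathscr T\zeta_1,\zeta_2)=T(\zeta_1,\zeta_2)$.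
   Context: Bardeen spacetime: the $4$-dimensional semi-Riemannian manifold with coordinates $(x^1,x^2,x^3,x^4)=(t,\rho,\theta,\phi)$, $\rho>0$, $0<\theta<\pi$, on the region where $\rho_1^3\ne 2M\rho^2$, with $\rho_1=(e^2+\rho^2)^{1/2}$ and metric $$g=-\Big(1-\tfrac{2M\rho^2}{\rho_1^3}\Big)dt^2+\Big(1-\tfrac{2M\rho^2}{\rho_1^3}\Big)^{-1}d\rho^2+\rho^2(d\theta^2+\sin^2\theta\,d\phi^2).$$ $n=4$, and $\nabla$ is the Levi-Civita connection. Einstein's equations are $S-\frac{\kappa}{2}g+\Lambda g=\frac{8\pi G}{c^4}T$, normalized by $\frac{8\pi G}{c^4}=1$, with $\Lambda$ the cosmological constant. $(\zeta_1\wedge_g\zeta_2)X=g(\zeta_2,X)\zeta_1-g(\zeta_1,X)\zeta_2$. Sign convention: $\mu_R(X,Y)Z=-(\nabla_X\nabla_YZ-\nabla_Y\nabla_XZ-\nabla_{[X,Y]}Z)$ and $S(X,Y)=\mathrm{tr}(Z\mapsto\mu_R(Z,X)Y)$; thus e.g. $R_{3434}=2M\rho^4\sin^2\theta/\rho_1^3$ and $S_{33}=-6Me^2\rho^2/\rho_1^5$. $\mathscr J$ is the Ricci operator, $g(\zeta_1,\mathscr J\zeta_2)=S(\zeta_1,\zeta_2)$, and $\kappa=\mathrm{tr}\,\mathscr J$. The conformal (Weyl) operator is $\mu_C(\zeta_1,\zeta_2)=\mu_R(\zeta_1,\zeta_2)-\frac{1}{n-2}(\zeta_1\wedge_g\mathscr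 J\zeta_2+\mathscr J\zeta_1\wedge_g\zeta_2)+\frac{\kappa}{(n-1)(n-2)}\zeta_1\wedge_g\zeta_2$. For $D\in\{R,C\}$ the $(0,4)$-tensor is $D(\zeta_1,\zeta_2,\zeta_3,\zeta_4)=g(\mu_D(\zeta_1,\zeta_2)\zeta_3,\zeta_4)$. For a $(0,2)$-tensor $T$: $(D\cdot T)(\zeta_1,\zeta_2;X,Y)=-T(\mu_D(X,Y)\zeta_1,\zeta_2)-T(\zeta_1,\mu_D(X,Y)\zeta_2)$ and $Q(g,T)(\zeta_1,\zeta_2;X,Y)=-T((X\wedge_gY)\zeta_1,\zeta_2)-T(\zeta_1,(X\wedge_gY)\zeta_2)$. *)

(* Defs.v *)
From HB Require Import structures.
From mathcomp Require Import all_boot all_order all_algebra.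
From mathcomp Require Import all_classical all_reals all_analysis.

Set Implicit Arguments.
Unset Strict Implicit.
Unset Printing Implicit Defensive.

Import Order.TTheory GRing.Theory Num.Theory.
Import numFieldNormedType.Exports.

Local Open Scope classical_set_scope.
Local Open Scope ring_scope.

(* Semi-Riemannian geometry on a subset U of R^m, m = n.+1, covered by one
   chart (U is meant to be open).  Fields are total functions on R^m, of which
   only the values on U matter: every hypothesis and every conclusion about
   them is restricted to U.  An operator such as a connection acts on fields,
   and tensors are evaluated on fields at a point. *)
Section Chart.
Variables (R : realType) (n : nat).

Notation point := 'rV[R]_n.+1.
Notation sfield := (point -> R).
Notation vfield := (point -> 'rV[R]_n.+1).

Implicit Types (U : set point) (f : sfield) (p : point).
Implicit Types (W X Y Z : vfield).

Definition partial (i : 'I_n.+1) f : sfield :=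
  fun p => 'D_(delta_mx 0 i) f p.

Fixpoint class_C (k : nat) U f : Prop :=
  (forall p, U p -> {for p, continuous f}) /\
  if k is l.+1 then
    forall i : 'I_n.+1,
      (forall p, U p -> derivable f p (delta_mx 0 i)) /\
      class_C l U (partial i f)
  else True.

Definition smooth_sfield U f : Prop := forall k, class_C k U f.

Definition smooth_vfield U X : Prop :=
  forall i : 'I_n.+1, smooth_sfield U (fun p => X p 0 i).

Definition coord_vfield (i : 'I_n.+1) : vfield := fun=> delta_mx 0 i.

Definition vderiv X f : sfield := fun p => \sum_i X p 0 i * partial i f p.

Definition lie_bracket X Y : vfield := fun p =>
  \row_k (vderiv X (fun q => Y q 0 k) p - vderiv Y (fun q => X q 0 k) p).

(* The value of the metric whose matrix in the coordinate frame is g. *)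
Definition metric (g : point -> 'M[R]_n.+1) X Y : sfield :=
  fun p => (X p *m g p *m (Y p)^T) 0 0.

Record affine_connection U (nabla : vfield -> vfield -> vfield) : Prop := {
  nabla_smooth : forall X Y, smooth_vfield U X -> smooth_vfield U Y ->
    smooth_vfield U (nabla X Y);
  nablaDl : forall X X' Y, smooth_vfield U X -> smooth_vfield U X' ->
    smooth_vfield U Y -> forall p, U p ->
    nabla (fun q => X q + X' q) Y p = nabla X Y p + nabla X' Y p;
  nablaZl : forall f X Y, smooth_sfield U f -> smooth_vfield U X ->
    smooth_vfield U Y -> forall p, U p ->
    nabla (fun q => f q *: X q) Y p = f p *: nabla X Y p;
  nablaDr : forall X Y Y', smooth_vfield U X -> smooth_vfield U Y ->
    smooth_vfield U Y' -> forall p, U p ->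
    nabla X (fun q => Y q + Y' q) p = nabla X Y p + nabla X Y' p;
  nabla_leibniz : forall f X Y, smooth_sfield U f -> smooth_vfield U X ->
    smooth_vfield U Y -> forall p, U p ->
    nabla X (fun q => f q *: Y q) p = vderiv X f p *: Y p + f p *: nabla X Y p
}.

Record levi_civita U (g : point -> 'M[R]_n.+1)
    (nabla : vfield -> vfield -> vfield) : Prop := {
  levi_civita_connection : affine_connection U nabla;
  levi_civita_torsion_free : forall X Y,
    smooth_vfield U X -> smooth_vfield U Y -> forall p, U p ->
    nabla X Y p - nabla Y X p = lie_bracket X Y p;
  levi_civita_metric : forall X Y Z, smooth_vfield U X -> smooth_vfield U Y ->
    smooth_vfield U Z -> forall p, U p ->
    vderiv X (metric g Y Z) p = metric g (nabla X Y) Z p + metric g Y (nabla X Z) p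
}.

(* The trace at each point of an endomorphism of the module of vector fields. *)
Definition vtrace (A : vfield -> vfield) : sfield :=
  fun p => \sum_i A (coord_vfield i) p 0 i.

(* The endomorphism A with B X Y = g(X, A Y), for a tensor B of type (0,2). *)
Definition metric_dual (g : point -> 'M[R]_n.+1) (B : vfield -> vfield -> sfield)
    Y : vfield :=
  fun p => (\row_i B (coord_vfield i) Y p) *m invmx (g p).

Definition wedge g X Y Z : vfield :=
  fun p => metric g Y Z p *: X p - metric g X Z p *: Y p.

(* The sign is opposite to the usual one, hence also that of [ricci]. *)
Definition riemann_op (nabla : vfield -> vfield -> vfield) X Y Z : vfield :=
  fun p => - (nabla X (nabla Y Z) p - nabla Y (nabla X Z) p
              - nabla (lie_bracket X Y) Z p).

Definition ricci nabla X Y : sfield :=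
  vtrace (fun Z => riemann_op nabla Z X Y).

Definition ricci_op g nabla : vfield -> vfield := metric_dual g (ricci nabla).

Definition scalar_curvature g nabla : sfield := vtrace (ricci_op g nabla).

Definition weyl_op g nabla X Y Z : vfield := fun p =>
  riemann_op nabla X Y Z p
  - (n.+1%:R - 2)^-1 *: (wedge g X (ricci_op g nabla Y) Z p
                         + wedge g (ricci_op g nabla X) Y Z p)
  + (scalar_curvature g nabla p / ((n.+1%:R - 1) * (n.+1%:R - 2)))
      *: wedge g X Y Z p.

Definition tensor04 g (D : vfield -> vfield -> vfield -> vfield) W X Y Z : sfield :=
  metric g (D W X Y) Z.

Definition energy_momentum g nabla (Lambda : R) X Y : sfield := fun p =>
  ricci nabla X Y p - scalar_curvature g nabla p / 2 * metric g X Y p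
  + Lambda * metric g X Y p.

(* D . T for an operator D; also Q(g, T), which is [tensor_dot (wedge g) T]. *)
Definition tensor_dot (D : vfield -> vfield -> vfield -> vfield)
    (T : vfield -> vfield -> sfield) W Z X Y : sfield :=
  fun p => - T (D X Y W) Z p - T W (D X Y Z) p.

Definition tachibana g T := tensor_dot (wedge g) T.

Definition compatible U g (D : vfield -> vfield -> vfield -> vfield)
    (T : vfield -> vfield -> sfield) : Prop :=
  (* the endomorphism A with g(A W, Z) = T W Z *)
  let A := metric_dual g (fun Z W => T W Z) in
  forall W Y Z X, smooth_vfield U W -> smooth_vfield U Y ->
    smooth_vfield U Z -> smooth_vfield U X -> forall p, U p ->
    tensor04 g D (A W) X Y Z p + tensor04 g D (A Y) X Z W p
    + tensor04 g D (A Z) X W Y p = 0.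

End Chart.

(* Coordinates are numbered from 0: (t, rho, theta, phi) = (p_0, p_1, p_2, p_3). *)
Section Bardeen.
Variable R : realType.
Implicit Types (M e : R) (p : 'rV[R]_4).

Definition rho p : R := p 0 (@Ordinal 4 1 isT).
Definition theta p : R := p 0 (@Ordinal 4 2 isT).

Definition rho1 e p : R := Num.sqrt (e ^+ 2 + rho p ^+ 2).

Definition bardeen_f M e p : R := 1 - 2 * M * rho p ^+ 2 / rho1 e p ^+ 3.

Definition bardeen_domain M e : set 'rV[R]_4 :=
  [set p | [/\ 0 < rho p, 0 < theta p, theta p < pi
             & rho1 e p ^+ 3 != 2 * M * rho p ^+ 2]].

Definition bardeen_metric M e p : 'M[R]_4 :=
  diag_mx (\row_i [:: - bardeen_f M e p; (bardeen_f M e p)^-1;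
                      rho p ^+ 2; rho p ^+ 2 * sin (theta p) ^+ 2]`_i).

End Bardeen.

(* Main.v *)
Require Import Defs.
From mathcomp Require Import all_boot all_order all_algebra.
From mathcomp Require Import all_classical all_reals all_analysis.
From mathcomp Require Import ring.

Import Order.TTheory GRing.Theory Num.Theory.
Import numFieldNormedType.Exports.

(** For a metric [diag (G_0, ..., G_n)] in a chart, suppose that in the
    coordinate frame the curvature operator is
    [R(e_i, e_j) = K_ij (e_i wedge e_j)] with [K] symmetric.  Then everything
    built from the curvature is diagonal: the Ricci tensor is [s_i G_i] with
    [s_i = sum_j K_ij], so the energy momentum tensor is [t_i G_i] with
    [t_i = s_i - kappa / 2 + Lambda], and the Weyl operator is again of the form
    [K'_ij (e_i wedge e_j)].  Two facts follow by pairing the summand at (l, m)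
    with the one at (m, l) ([sum_antisym]).  The cyclic sum in the compatibility
    condition vanishes for every symmetric [K] ([compatible_diag]).  And in
    [D . T - b Q(g, T)] such a pair carries the factor
    [(t_l - t_m) (K_lm - b)], so that [D . T = b Q(g, T)] as soon as [K_lm = b]
    for every pair of directions that [T] distinguishes
    ([tensor_dot_tachibana]).

    A static metric [- F dt^2 + F^-1 drho^2 + rho^2 (dtheta^2 + sin^2 theta dphi^2)]
    is of this kind ([sectional_static]): with the present sign, [K] is [F'' / 2]
    on the plane (t, rho), [(F - 1) / rho^2] on the plane (theta, phi), and
    [F' / (2 rho)] on each of the four mixed planes.  Hence [T] has one
    eigenvalue on each of the blocks {t, rho} and {theta, phi}, and the mixed
    value of [K], or of its Weyl analogue, is the factor of pseudosymmetry.  For [F = 1 - 2 M rho^2 / rho_1^3] these two values are the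
    announced ones.

    What remains is to compute the curvature of an arbitrary torsion-free metric
    connection, given only by its axioms on fields smooth on an open set.  The
    connection is local ([nabla_extl], [nabla_extr]), hence determined by its
    Christoffel symbols, which the Koszul formula computes ([koszul],
    [christoffel_diag]).  The curvature operator is tensorial
    ([riemann_op_tensorial_dir], [riemann_op_tensorial_arg]); this rests on the
    symmetry of second partial derivatives ([derive_comm]). *)

Set Implicit Arguments.
Unset Strict Implicit.
Unset Printing Implicit Defensive.

Local Open Scope classical_set_scope.
Local Open Scope ring_scope.

(** * Mixed directional derivatives *)

Section DirectionalDerivatives.
Variables (R : realType) (V : normedModType R).
Implicit Types (f : V -> R) (p u v w : V).

Lemma is_derive_line f u w (x : R) : derivable f (x *: u + w) u ->
  is_derive x 1 (fun y : R => f (y *: u + w)) ('D_u f (x *: u + w)).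
Proof.
rewrite /derivable => fu.
have E : (fun h : R => h^-1 *: (((fun y : R => f (y *: u + w)) \o shift x) (h *: (1 : R))
            - f (x *: u + w)))
       = (fun h : R => h^-1 *: ((f \o shift (x *: u + w)) (h *: u) - f (x *: u + w))).
  by apply/funext => h /=; rewrite [h *: (1 : R)]mulr1 scalerDl addrA.
by split; rewrite /derivable /derive E.
Qed.

Lemma is_derive_comp_dir (phi : R -> R) f p v (a b : R) :
  is_derive (f p) 1 phi a -> is_derive p v f b ->
  is_derive p v (fun q => phi (f q)) (a * b).
Proof.
move=> dphi df.
pose l h := f (h *: v + p).
have l0 : l 0 = f p by rewrite /l scale0r add0r.
have dl : is_derive (0 : R) 1 l b.
  rewrite -(@derive_val _ _ _ _ _ _ _ df).
  have := @is_derive_line f v p 0; rewrite scale0r add0r; apply.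
  exact: ex_derive.
have [dc cE] : is_derive (0 : R) 1 (phi \o l) (a * b).
  by apply: is_derive1_comp; rewrite l0.
split; first exact/(derivable1P (fun q => phi (f q)) p v).2.
rewrite -cE /derive.
set F := (X in lim (X @ _) = _); set G := (X in _ = lim (X @ _)).
suff -> : F = G by [].
apply/funext => h; rewrite /F /G /= /l addr0 scale0r add0r.
by rewrite [h *: (1 : R)]mulr1.
Qed.

(** The mean value theorem is used once in each direction. *)
Lemma second_difference f u v p (s : R) : 0 < s ->
  (forall x y, 0 <= x <= s -> 0 <= y <= s ->
     derivable f (x *: u + (y *: v + p)) u /\
     derivable ('D_u f) (x *: u + (y *: v + p)) v) ->
  exists x y, [/\ 0 <= x <= s, 0 <= y <= s &
    f (s *: u + (s *: v + p)) - f (s *: u + p) - f (s *: v + p) + f p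
    = s ^+ 2 * 'D_v ('D_u f) (x *: u + (y *: v + p))].
Proof.
move=> s0 df.
have s_itv : 0 <= s <= s by rewrite lexx ltW.
have z_itv : 0 <= (0 : R) <= s by rewrite lexx ltW.
pose G x := f (x *: u + (s *: v + p)) - f (x *: u + p).
pose G' x := 'D_u f (x *: u + (s *: v + p)) - 'D_u f (x *: u + p).
have dG x : 0 <= x <= s -> is_derive x 1 G (G' x).
  move=> xs; have [d1 _] := df x s xs s_itv.
  have [+ _] := df x 0 xs z_itv; rewrite scale0r add0r => d2.
  exact: (is_deriveB (is_derive_line d1) (is_derive_line d2)).
have [||x xs GE] := @MVT R G G' 0 s s0.
- by move=> x /[!in_itv]/= /andP[x0 xs]; apply: dG; rewrite !ltW.
- apply: derivable_within_continuous => x /[!in_itv]/= xs.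
  exact: (@ex_derive _ _ _ _ _ _ _ (dG x xs)).
have {}xs : 0 <= x <= s by move: xs; rewrite in_itv/= => /andP[? ?]; rewrite !ltW.
pose H y := 'D_u f (y *: v + (x *: u + p)).
have dH y : 0 <= y <= s -> is_derive y 1 H ('D_v ('D_u f) (y *: v + (x *: u + p))).
  move=> ys; apply: is_derive_line; rewrite addrCA.
  by have [] := df x y xs ys.
have [||y ys HE] := @MVT R H (fun y => 'D_v ('D_u f) (y *: v + (x *: u + p))) 0 s s0.
- by move=> y /[!in_itv]/= /andP[y0 ys]; apply: dH; rewrite !ltW.
- apply: derivable_within_continuous => y /[!in_itv]/= ys.
  exact: (@ex_derive _ _ _ _ _ _ _ (dH y ys)).
have {}ys : 0 <= y <= s by move: ys; rewrite in_itv/= => /andP[? ?]; rewrite !ltW.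
exists x, y; split => //.
move: GE; rewrite /G /G' !scale0r !add0r subr0 opprB => GE.
move: HE; rewrite /H !scale0r !add0r subr0 !(addrCA _ (x *: u)) => HE.
by rewrite addrA in GE; rewrite expr2 -mulrA mulrC [s * _]mulrC -HE -GE; ring.
Qed.

Let close_half (a b x eps : R) :
  `|a - x| < eps / 2 -> `|b - x| < eps / 2 -> `|a - b| <= eps.
Proof.
move=> ax bx; rewrite (splitr eps) (le_trans (ler_distD x _ _))// lerD ?ltW//.
by rewrite distrC.
Qed.

(** Both orders of differentiation are values, near p, of the same second
    difference divided by s^2, hence their values at p differ by less than any
    positive number. *)
Lemma derive_comm f u v p :
  (\forall q \near p, [/\ derivable f q u, derivable f q v,
      derivable ('D_u f) q v & derivable ('D_v f) q u]) ->
  {for p, continuous ('D_v ('D_u f))} -> {for p, continuous ('D_u ('D_v f))} ->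
  'D_v ('D_u f) p = 'D_u ('D_v f) p.
Proof.
move=> df cvu cuv; apply/eqP; rewrite -subr_eq0 -normr_le0.
apply/ler_addgt0Pr => eps eps0; rewrite add0r.
have e20 : 0 < eps / 2 by rewrite divr_gt0.
have N : \forall q \near p, [/\ derivable f q u, derivable f q v,
      derivable ('D_u f) q v & derivable ('D_v f) q u] /\
   `|'D_v ('D_u f) p - 'D_v ('D_u f) q| < eps / 2 /\
   `|'D_u ('D_v f) p - 'D_u ('D_v f) q| < eps / 2.
  have /cvgrPdist_lt/(_ _ e20) n1 := cvu.
  have /cvgrPdist_lt/(_ _ e20) n2 := cuv.
  exact: (filterI df (filterI n1 n2)).
have /nbhs_ballP[d /= d0 box] := N.
pose c := `|u| + `|v| + 1.
have c0 : 0 < c by rewrite ltr_wpDl// addr_ge0.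
pose s := d / c.
have s0 : 0 < s by rewrite divr_gt0.
have inb x y : 0 <= x <= s -> 0 <= y <= s ->
    ball p d (x *: u + (y *: v + p)).
  move=> /andP[x0 xs] /andP[y0 ys]; rewrite -ball_normE /= addrA opprD addrCA subrr addr0.
  rewrite normrN (le_lt_trans (ler_normD _ _))// !normrZ !ger0_norm//.
  have -> : d = s * (`|u| + `|v|) + s by rewrite -{2}[s]mulr1 -mulrDr divfK// gt_eqF.
  by rewrite ltr_pwDr// mulrDr lerD// ler_wpM2r.
have [|x1 [y1 [x1s y1s E1]]] := @second_difference f u v p s s0.
  by move=> x y xs ys; have [[]] := box _ (inb _ _ xs ys).
have [|x2 [y2 [x2s y2s E2]]] := @second_difference f v u p s s0.
  move=> x y xs ys; rewrite (addrCA (x *: v)).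
  by have [[_ fv _ fvu] _] := box _ (inb _ _ ys xs); split.
have [_ [B1 _]] := box _ (inb _ _ x1s y1s).
have [_ [_ B2]] := box _ (inb _ _ y2s x2s).
have E : 'D_v ('D_u f) (x1 *: u + (y1 *: v + p)) =
         'D_u ('D_v f) (y2 *: u + (x2 *: v + p)).
  apply: (@mulfI _ (s ^+ 2)); first by rewrite expf_neq0// gt_eqF.
  rewrite (addrCA (x2 *: v)) (addrCA (s *: v)) in E2.
  apply: (etrans (esym E1)); apply: (etrans _ E2).
  by congr (_ + _); exact: addrAC.
move: B1 B2; rewrite E => B1 B2.
exact: (close_half B1 B2).
Qed.

End DirectionalDerivatives.

(** * Smooth functions on an open set *)

Section SmoothFields.
Variables (R : realType) (n : nat).

Notation point := 'rV[R]_n.+1.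
Notation sfield := (point -> R).

Variable U : set point.
Hypothesis oU : open U.

Implicit Types (f g : sfield) (p : point).

(** The predicate [class_C] constrains functions at the points of [U] only; as
    [U] is open, so does differentiation, and all that follows can be done up to
    equality on [U]. *)
Lemma eq_on_near f g p : (forall q, U q -> f q = g q) -> U p ->
  \forall q \near p, f q = g q.
Proof. by move=> fg Up; apply: filterS (open_nbhs_nbhs (conj oU Up)). Qed.

Lemma partial_ext i f g p : (forall q, U q -> f q = g q) -> U p ->
  partial i f p = partial i g p.
Proof. by move=> fg Up; apply: near_eq_derive; exact: eq_on_near. Qed.

Lemma derivable_ext f g p v : (forall q, U q -> f q = g q) -> U p ->
  derivable f p v -> derivable g p v.
Proof. by move=> fg Up; apply: near_eq_derivable; exact: eq_on_near. Qed.

Lemma continuous_ext f g p : (forall q, U q -> f q = g q) -> U p ->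
  {for p, continuous f} -> {for p, continuous g}.
Proof.
move=> fg Up cf; rewrite /prop_for /continuous_at -(fg p Up).
exact: cvg_trans (near_eq_cvg (eq_on_near fg Up)) cf.
Qed.

Lemma class_C_ext k f g : (forall q, U q -> f q = g q) ->
  class_C k U f -> class_C k U g.
Proof.
elim: k f g => [|k IHk] f g fg [cf df]; split=> //.
- by move=> p Up; apply: continuous_ext fg Up (cf p Up).
- by move=> p Up; apply: continuous_ext fg Up (cf p Up).
move=> i; have [dif Cf] := df i; split=> [p Up|].
  exact: derivable_ext fg Up (dif p Up).
by apply: IHk Cf => q Uq; apply: partial_ext.
Qed.

Lemma smooth_ext f g : (forall q, U q -> f q = g q) ->
  smooth_sfield U f -> smooth_sfield U g.
Proof. by move=> fg sf k; apply: class_C_ext fg (sf k). Qed.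

Lemma class_CS k f : class_C k.+1 U f -> class_C k U f.
Proof.
elim: k f => [|k IHk] f [cf df]; split=> // i.
by have [dif Cf] := df i; split=> //; apply: IHk.
Qed.

Lemma class_C_continuous k f p : class_C k U f -> U p -> {for p, continuous f}.
Proof. by case: k => [|k] [cf _] /cf. Qed.

Lemma smooth_continuous f p : smooth_sfield U f -> U p -> {for p, continuous f}.
Proof. by move=> /(_ 0%N); exact: class_C_continuous. Qed.

Lemma smooth_derivable f i p : smooth_sfield U f -> U p ->
  derivable f p (delta_mx 0 i).
Proof. by move=> /(_ 1%N) [_ /(_ i) [df _]] /df. Qed.

Lemma smooth_partial f i : smooth_sfield U f -> smooth_sfield U (partial i f).
Proof. by move=> sf k; have [_ /(_ i) []] := sf k.+1. Qed.

Lemma partial_comm i j f p : smooth_sfield U f -> U p ->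
  partial i (partial j f) p = partial j (partial i f) p.
Proof.
move=> sf Up; apply: derive_comm.
- apply: filterS (open_nbhs_nbhs (conj oU Up)) => q Uq.
  split; [exact: smooth_derivable sf Uq|exact: smooth_derivable sf Uq| |].
    exact: (smooth_derivable (smooth_partial j sf) Uq).
  exact: (smooth_derivable (smooth_partial i sf) Uq).
- exact: (smooth_continuous (smooth_partial i (smooth_partial j sf)) Up).
- exact: (smooth_continuous (smooth_partial j (smooth_partial i sf)) Up).
Qed.

Lemma class_C_cst k (c : R) : class_C k U (fun=> c).
Proof.
elim: k c => [|k IHk] c; split=> //.
- by move=> p _; exact: cst_continuous.
- by move=> p _; exact: cst_continuous.
move=> i; split=> [p _|]; first exact: derivable_cst.
by apply: class_C_ext (IHk 0) => q _; rewrite /partial derive_cst.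
Qed.

Lemma partial_cst i (c : R) p : partial i (fun=> c) p = 0.
Proof. exact: derive_cst. Qed.

Section Derivations.
Variables (f g : sfield) (i : 'I_n.+1) (p : point).
Hypotheses (df : derivable f p (delta_mx 0 i)) (dg : derivable g p (delta_mx 0 i)).

Lemma derivable_add : derivable (fun q => f q + g q) p (delta_mx 0 i).
Proof. exact: derivableD. Qed.

Lemma derivable_mul : derivable (fun q => f q * g q) p (delta_mx 0 i).
Proof. exact: derivableM df dg. Qed.

Lemma partial_add :
  partial i (fun q => f q + g q) p = partial i f p + partial i g p.
Proof. exact: deriveD. Qed.

Lemma partial_mul :
  partial i (fun q => f q * g q) p = partial i f p * g p + f p * partial i g p.
Proof.
by rewrite [LHS](deriveM df dg) addrC; congr (_ + _); exact: mulrC.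
Qed.

End Derivations.

Lemma class_CD k f g : class_C k U f -> class_C k U g ->
  class_C k U (fun q => f q + g q).
Proof.
elim: k f g => [|k IHk] f g [cf df] [cg dg]; split=> //.
- by move=> p Up; apply: continuousD; [exact: cf|exact: cg].
- by move=> p Up; apply: continuousD; [exact: cf|exact: cg].
move=> i; have [dif Cf] := df i; have [dig Cg] := dg i; split=> [p Up|].
  by apply: derivable_add; [exact: dif|exact: dig].
apply: class_C_ext (IHk _ _ Cf Cg) => q Uq.
by rewrite partial_add//; [exact: dif|exact: dig].
Qed.

Lemma class_CM k f g : class_C k U f -> class_C k U g ->
  class_C k U (fun q => f q * g q).
Proof.
elim: k f g => [|k IHk] f g Cf Cg; split=> //.
- by move=> p Up; apply: continuousM; apply: class_C_continuous Up; eassumption.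
- by move=> p Up; apply: continuousM; apply: class_C_continuous Up; eassumption.
move=> i; have [cf df] := Cf; have [cg dg] := Cg.
have [dif Cif] := df i; have [dig Cig] := dg i; split=> [p Up|].
  by apply: derivable_mul; [exact: dif|exact: dig].
have := class_CD (IHk _ _ Cif (class_CS Cg)) (IHk _ _ (class_CS Cf) Cig).
apply: class_C_ext => q Uq.
by rewrite partial_mul//; [exact: dif|exact: dig].
Qed.

Lemma smooth_cst (c : R) : smooth_sfield U (fun=> c).
Proof. by move=> k; apply: class_C_cst. Qed.

Lemma smoothD f g : smooth_sfield U f -> smooth_sfield U g ->
  smooth_sfield U (fun q => f q + g q).
Proof. by move=> sf sg k; apply: class_CD. Qed.

Lemma smoothM f g : smooth_sfield U f -> smooth_sfield U g ->
  smooth_sfield U (fun q => f q * g q).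
Proof. by move=> sf sg k; apply: class_CM. Qed.

Lemma smoothZ (c : R) f : smooth_sfield U f -> smooth_sfield U (fun q => c * f q).
Proof. exact/smoothM/smooth_cst. Qed.

Lemma smoothN f : smooth_sfield U f -> smooth_sfield U (fun q => - f q).
Proof.
by move/(smoothZ (-1)); apply: smooth_ext => q _; rewrite mulN1r.
Qed.

Lemma smoothB f g : smooth_sfield U f -> smooth_sfield U g ->
  smooth_sfield U (fun q => f q - g q).
Proof. by move=> sf /smoothN; exact: smoothD. Qed.

Lemma smoothX f m : smooth_sfield U f -> smooth_sfield U (fun q => f q ^+ m).
Proof.
move=> sf; elim: m => [|m IHm].
  by apply: smooth_ext (smooth_cst 1) => q _; rewrite expr0.
by apply: smooth_ext (smoothM sf IHm) => q _; rewrite exprS.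
Qed.

Lemma smooth_sum (I : Type) (r : seq I) (F : I -> sfield) :
  (forall i, smooth_sfield U (F i)) ->
  smooth_sfield U (fun q => \sum_(i <- r) F i q).
Proof.
move=> sF; elim: r => [|i r IHr].
  by apply: smooth_ext (smooth_cst 0) => q _; rewrite big_nil.
by apply: smooth_ext (smoothD (sF i) IHr) => q _; rewrite big_cons.
Qed.

Let is_derive_coordinate i (p v : point) :
  is_derive p v (fun q : point => q 0 i : R) (v 0 i).
Proof.
have E : (fun h : R => h^-1 *: (((fun q : point => q 0 i : R) \o shift p) (h *: v)
     - p 0 i)) @ 0^' --> v 0 i.
  apply: (@cvg_trans _ ((fun=> v 0 i) @ 0^')); last exact: cvg_cst.
  apply: near_eq_cvg; near=> h; rewrite /= !mxE addrK.
  rewrite [RHS]mulrA mulVf ?mul1r//.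
  by near: h; exact: nbhs_dnbhs_neq.
by split; [apply/cvg_ex; exists (v 0 i)|exact: cvg_lim E].
Unshelve. all: by end_near. Qed.

Lemma partial_coordinate j i p : partial j (fun q => q 0 i) p = (j == i)%:R.
Proof.
rewrite /partial (@derive_val _ _ _ _ _ _ _ (is_derive_coordinate i p _)).
by rewrite mxE eqxx eq_sym.
Qed.

Lemma smooth_coordinate i : smooth_sfield U (fun q => q 0 i).
Proof.
case=> [|k]; split=> //.
- by move=> p _; apply: coord_continuous.
- by move=> p _; apply: coord_continuous.
move=> j; split=> [p _|].
  exact: (@ex_derive _ _ _ _ _ _ _ (is_derive_coordinate i p _)).
by apply: class_C_ext (class_C_cst k (j == i)%:R) => q _; rewrite partial_coordinate.
Qed.

Section Composition.
Variables (phi phi' : R -> R) (f : sfield).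
Hypothesis dphi : forall p, U p -> is_derive (f p) 1 phi (phi' (f p)).
Hypothesis sf : smooth_sfield U f.

Lemma partial_comp i p : U p ->
  partial i (fun q => phi (f q)) p = phi' (f p) * partial i f p.
Proof.
move=> Up; have dfi := derivableP (smooth_derivable (i := i) sf Up).
exact: (@derive_val _ _ _ _ _ _ _ (is_derive_comp_dir (dphi Up) dfi)).
Qed.

Lemma continuous_comp_smooth p : U p -> {for p, continuous (fun q => phi (f q))}.
Proof.
move=> Up; apply: (@continuous_comp _ _ _ f phi).
  exact: smooth_continuous sf Up.
apply/differentiable_continuous/derivable1_diffP.
exact: (@ex_derive _ _ _ _ _ _ _ (dphi Up)).
Qed.

(** This gains one order at a time, so that the smoothness of inverses, square
    roots and of the pair (sin, cos) follows by induction on the order: their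
    derivatives are expressed by the same functions. *)
Lemma class_CS_comp k : class_C k U (fun q => phi' (f q)) ->
  class_C k.+1 U (fun q => phi (f q)).
Proof.
move=> Cphi'; split=> [p|i]; first exact: continuous_comp_smooth.
split=> [p Up|].
  have dfi := derivableP (smooth_derivable (i := i) sf Up).
  exact: (@ex_derive _ _ _ _ _ _ _ (is_derive_comp_dir (dphi Up) dfi)).
apply: class_C_ext (class_CM Cphi' (smooth_partial i sf k)) => q Uq.
by rewrite partial_comp.
Qed.

Lemma smooth_comp_ind :
  (forall k, class_C k U (fun q => phi (f q)) ->
             class_C k U (fun q => phi' (f q))) ->
  smooth_sfield U (fun q => phi (f q)).
Proof.
move=> H; elim=> [|k IHk]; last exact/class_CS_comp/H.
by split=> // p; apply: continuous_comp_smooth.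
Qed.

End Composition.

Lemma smoothV f : smooth_sfield U f -> (forall p, U p -> f p != 0) ->
  smooth_sfield U (fun q => (f q)^-1).
Proof.
move=> sf f0.
have dV p : U p -> is_derive (f p) 1 (@GRing.inv R) ((fun x => - x ^- 2) (f p)).
  move=> Up; have := @is_deriveV R id (f p) 1 1 (f0 p Up) (is_derive_id _ _).
  by rewrite [_ *: _]mulr1.
apply: (smooth_comp_ind (phi' := fun x => - x ^- 2) dV sf) => k IHk.
apply: class_C_ext (class_CM (class_C_cst k (-1)) (class_CM IHk IHk)) => q _.
by rewrite mulN1r expr2 invfM.
Qed.

Lemma smooth_sqrt f : smooth_sfield U f -> (forall p, U p -> 0 < f p) ->
  smooth_sfield U (fun q => Num.sqrt (f q)).
Proof.
move=> sf f0.
(* The derivative is written with sqrt in the numerator, so that the remaining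
   denominator is the smooth function 2 f. *)
have dS p : U p ->
    is_derive (f p) 1 Num.sqrt ((fun x => Num.sqrt x * (2 * x)^-1) (f p)).
  move=> Up; have fp := f0 p Up.
  apply: (@is_derive_eq _ _ _ _ _ _ _ _ (is_derive1_sqrt fp)).
  have s0 : Num.sqrt (f p) != 0 by rewrite gt_eqF// sqrtr_gt0.
  rewrite -{3}(sqr_sqrtr (ltW fp)).
  by move: s0; move: (Num.sqrt _) => s s0; field.
have s2f : smooth_sfield U (fun q => (2 * f q)^-1).
  by apply: smoothV (smoothZ 2 sf) _ => p Up; rewrite mulf_neq0// gt_eqF// f0.
apply: (smooth_comp_ind (phi' := fun x => Num.sqrt x * (2 * x)^-1) dS sf) => k IHk.
exact: (class_CM IHk (s2f k)).
Qed.

Lemma smooth_sin_cos f : smooth_sfield U f ->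
  smooth_sfield U (fun q => sin (f q)) /\ smooth_sfield U (fun q => cos (f q)).
Proof.
move=> sf.
have dS p : U p -> is_derive (f p) 1 sin (cos (f p)).
  by move=> _; exact: is_derive_sin.
have dC p : U p -> is_derive (f p) 1 cos ((fun x => - sin x) (f p)).
  by move=> _; exact: is_derive_cos.
suff H k : class_C k U (fun q => sin (f q)) /\ class_C k U (fun q => cos (f q)).
  by split=> k; have [] := H k.
elim: k => [|k [IHs IHc]].
  by split; split=> // p; [apply: (continuous_comp_smooth (phi' := cos) dS)|
                           apply: (continuous_comp_smooth (phi' := fun x => - sin x) dC)].
split; first exact: (class_CS_comp (phi' := cos) dS sf IHc).
apply: (class_CS_comp (phi' := fun x => - sin x) dC sf).
apply: class_C_ext (class_CM (class_C_cst k (-1)) IHs) => q _.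
by rewrite mulN1r.
Qed.

End SmoothFields.

(** * Affine connections in a chart *)

Section VectorFields.
Variables (R : realType) (n : nat).

Notation point := 'rV[R]_n.+1.
Notation sfield := (point -> R).
Notation vfield := (point -> 'rV[R]_n.+1).

Variable U : set point.
Hypothesis oU : open U.

Implicit Types (f : sfield) (p : point) (X Y Z W : vfield).

Lemma smooth_vfield_ext X Y : (forall q, U q -> X q = Y q) ->
  smooth_vfield U X -> smooth_vfield U Y.
Proof. by move=> XY sX i; apply: (smooth_ext oU) (sX i) => q /XY ->. Qed.

Lemma smooth_row (F : 'I_n.+1 -> sfield) : (forall i, smooth_sfield U (F i)) ->
  smooth_vfield U (fun q => \row_i F i q).
Proof. by move=> sF i; apply: (smooth_ext oU) (sF i) => q _; rewrite mxE. Qed.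

Lemma smooth_coord_vfield i : smooth_vfield U (@coord_vfield R n i).
Proof. by move=> j; apply: smooth_cst. Qed.

Lemma smooth_vfield0 : smooth_vfield U (fun=> 0).
Proof. by move=> j; apply: smooth_cst. Qed.

Lemma smooth_vfieldD X Y : smooth_vfield U X -> smooth_vfield U Y ->
  smooth_vfield U (fun q => X q + Y q).
Proof.
move=> sX sY i; apply: (smooth_ext oU) (smoothD oU (sX i) (sY i)) => q _.
by rewrite mxE.
Qed.

Lemma smooth_vfieldZ f X : smooth_sfield U f -> smooth_vfield U X ->
  smooth_vfield U (fun q => f q *: X q).
Proof.
move=> sf sX i; apply: (smooth_ext oU) (smoothM oU sf (sX i)) => q _.
by rewrite mxE.
Qed.

Lemma smooth_vfieldN X : smooth_vfield U X -> smooth_vfield U (fun q => - X q).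
Proof.
move=> /(smooth_vfieldZ (smooth_cst oU (-1))); apply: smooth_vfield_ext => q _.
by rewrite scaleN1r.
Qed.

Lemma smooth_vfieldB X Y : smooth_vfield U X -> smooth_vfield U Y ->
  smooth_vfield U (fun q => X q - Y q).
Proof. by move=> sX /smooth_vfieldN; exact: smooth_vfieldD. Qed.

Lemma smooth_vderiv X f : smooth_vfield U X -> smooth_sfield U f ->
  smooth_sfield U (vderiv X f).
Proof.
move=> sX sf; apply: smooth_sum => // i; apply: smoothM => //.
exact: smooth_partial.
Qed.

Lemma smooth_lie_bracket X Y : smooth_vfield U X -> smooth_vfield U Y ->
  smooth_vfield U (lie_bracket X Y).
Proof.
by move=> sX sY; apply: smooth_row => i; apply: smoothB => //;
  apply: smooth_vderiv.
Qed.

Lemma vderiv_coord i f p : vderiv (coord_vfield i) f p = partial i f p.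
Proof.
rewrite /vderiv (bigD1 i)//= big1 ?addr0 => [|j ji]; rewrite !mxE !eqxx.
  by rewrite mul1r.
by rewrite (negPf ji) mul0r.
Qed.

Lemma lie_bracket_coord i j :
  lie_bracket (@coord_vfield R n i) (coord_vfield j) = fun=> 0.
Proof.
apply/funext => q; apply/rowP => k.
by rewrite !mxE !vderiv_coord !partial_cst subrr !mxE.
Qed.

Variable nabla : vfield -> vfield -> vfield.
Hypothesis cn : affine_connection U nabla.

Lemma nabla0l Y p : smooth_vfield U Y -> U p -> nabla (fun=> 0) Y p = 0.
Proof.
move=> sY Up.
have := nablaZl cn (smooth_cst oU 0) smooth_vfield0 sY Up.
by under [X in nabla X]eq_fun do rewrite scaler0; rewrite scale0r => ->.
Qed.

Lemma nabla0r X p : smooth_vfield U X -> U p -> nabla X (fun=> 0) p = 0.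
Proof.
move=> sX Up.
have := nabla_leibniz cn (smooth_cst oU 0) sX smooth_vfield0 Up.
under [X in nabla _ X]eq_fun do rewrite scaler0.
by rewrite scaler0 scale0r addr0 => ->.
Qed.

(** A field that vanishes on U is its own product with the indicator function
    of the complement of U, which is smooth on U because it is zero there; the
    product rules then make the connection vanish on it. *)
Let off_U : sfield := fun q => (q \notin U)%:R.

Let smooth_off_U : smooth_sfield U off_U.
Proof.
by apply: (smooth_ext oU) (smooth_cst oU 0) => q Uq; rewrite /off_U mem_set.
Qed.

Let off_UZ X : (forall q, U q -> X q = 0) -> (fun q => off_U q *: X q) = X.
Proof.
move=> X0; apply/funext => q; rewrite /off_U.
have [/set_mem/X0 ->|_] := boolP (q \in U); first by rewrite scaler0.
by rewrite scale1r.
Qed.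

Lemma nabla_extl X X' Y p : (forall q, U q -> X q = X' q) ->
  smooth_vfield U X -> smooth_vfield U Y -> U p -> nabla X Y p = nabla X' Y p.
Proof.
move=> XX' sX sY Up; have sX' := smooth_vfield_ext XX' sX.
have D0 q : U q -> X q - X' q = 0 by move=> Uq; rewrite XX' ?subrr.
have -> : X = fun q => X' q + (X q - X' q) by apply/funext => q; rewrite addrC subrK.
have sD := smooth_vfieldB sX sX'.
rewrite (nablaDl cn sX' sD sY Up) -{1}(off_UZ D0).
by rewrite (nablaZl cn smooth_off_U sD sY Up) /off_U mem_set// scale0r addr0.
Qed.

Lemma nabla_extr X Y Y' p : (forall q, U q -> Y q = Y' q) ->
  smooth_vfield U X -> smooth_vfield U Y -> U p -> nabla X Y p = nabla X Y' p.
Proof.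
move=> YY' sX sY Up; have sY' := smooth_vfield_ext YY' sY.
have D0 q : U q -> Y q - Y' q = 0 by move=> Uq; rewrite YY' ?subrr.
have -> : Y = fun q => Y' q + (Y q - Y' q) by apply/funext => q; rewrite addrC subrK.
have sD := smooth_vfieldB sY sY'.
rewrite (nablaDr cn sX sY' sD Up) -{1}(off_UZ D0).
rewrite (nabla_leibniz cn smooth_off_U sX sD Up) D0// scaler0 add0r.
by rewrite /off_U mem_set// scale0r addr0.
Qed.

Section Combinations.
Variables (I : Type) (f : I -> sfield) (Y : I -> vfield).
Hypotheses (sf : forall i, smooth_sfield U (f i))
           (sY : forall i, smooth_vfield U (Y i)).

Lemma smooth_combination (r : seq I) :
  smooth_vfield U (fun q => \sum_(i <- r) f i q *: Y i q).
Proof.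
move=> j; apply: (smooth_ext oU)
  (smooth_sum oU r (fun i => smoothM oU (sf i) (sY i j))) => q _.
by rewrite summxE; apply: eq_bigr => i _; rewrite mxE.
Qed.

(** Coordinate fields form a global frame, so the axioms need only be extended
    from sums and products to finite combinations. *)
Lemma nabla_combinationl (r : seq I) X p : smooth_vfield U X -> U p ->
  nabla (fun q => \sum_(i <- r) f i q *: Y i q) X p
  = \sum_(i <- r) f i p *: nabla (Y i) X p.
Proof.
move=> sX Up; elim: r => [|i r IHr].
  by under [Z in nabla Z]eq_fun do rewrite big_nil; rewrite big_nil nabla0l.
under [Z in nabla Z]eq_fun do rewrite big_cons.
rewrite big_cons -IHr.
rewrite (nablaDl cn (smooth_vfieldZ (sf i) (sY i)) (smooth_combination r) sX Up).
by rewrite (nablaZl cn (sf i) (sY i) sX Up).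
Qed.

Lemma nabla_combinationr (r : seq I) X p : smooth_vfield U X -> U p ->
  nabla X (fun q => \sum_(i <- r) f i q *: Y i q) p
  = \sum_(i <- r) (vderiv X (f i) p *: Y i p + f i p *: nabla X (Y i) p).
Proof.
move=> sX Up; elim: r => [|i r IHr].
  by under [Z in nabla _ Z]eq_fun do rewrite big_nil; rewrite big_nil nabla0r.
under [Z in nabla _ Z]eq_fun do rewrite big_cons.
rewrite big_cons -IHr.
rewrite (nablaDr cn sX (smooth_vfieldZ (sf i) (sY i)) (smooth_combination r) Up).
by rewrite (nabla_leibniz cn (sf i) sX (sY i) Up).
Qed.

End Combinations.

Local Notation e_ := (@coord_vfield R n).

Lemma coord_expansion X : X = fun q => \sum_i X q 0 i *: e_ i q.
Proof. by apply/funext => q; exact: row_sum_delta. Qed.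

Lemma nabla_coordl X Y p : smooth_vfield U X -> smooth_vfield U Y -> U p ->
  nabla X Y p = \sum_i X p 0 i *: nabla (e_ i) Y p.
Proof.
move=> sX sY Up; rewrite {1}(coord_expansion X).
exact: (nabla_combinationl (fun i => sX i) smooth_coord_vfield).
Qed.

Let nablaS := nabla_smooth cn.

Lemma smooth_riemann_op X Y Z : smooth_vfield U X -> smooth_vfield U Y ->
  smooth_vfield U Z -> smooth_vfield U (riemann_op nabla X Y Z).
Proof.
move=> sX sY sZ; apply/smooth_vfieldN/smooth_vfieldB.
  by apply: smooth_vfieldB; do 2 apply: nablaS => //.
by apply: nablaS => //; apply: smooth_lie_bracket.
Qed.

Lemma riemann_op_coord i j Z p : smooth_vfield U Z -> U p ->
  riemann_op nabla (e_ i) (e_ j) Z p =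
  - (nabla (e_ i) (nabla (e_ j) Z) p - nabla (e_ j) (nabla (e_ i) Z) p).
Proof. by move=> sZ Up; rewrite /riemann_op lie_bracket_coord nabla0l// subr0. Qed.

(** The first sum is the part that fails to be tensorial in X and Y; after
    antisymmetrization it is the derivative along the bracket. *)
Lemma nabla2_coord X Y Z p : smooth_vfield U X -> smooth_vfield U Y ->
  smooth_vfield U Z -> U p ->
  nabla X (nabla Y Z) p =
  \sum_j vderiv X (fun q => Y q 0 j) p *: nabla (e_ j) Z p +
  \sum_i \sum_j (X p 0 i * Y p 0 j) *: nabla (e_ i) (nabla (e_ j) Z) p.
Proof.
move=> sX sY sZ Up.
have se := smooth_coord_vfield.
have sn j : smooth_vfield U (nabla (e_ j) Z) by exact: nablaS.
have E q : U q -> nabla Y Z q = \sum_j Y q 0 j *: nabla (e_ j) Z q.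
  exact: nabla_coordl.
rewrite (nabla_extr E sX (nablaS sY sZ) Up).
rewrite (nabla_combinationr (fun j => sY j) sn _ sX Up) big_split/=.
congr (_ + _); rewrite exchange_big/=; apply: eq_bigr => j _.
rewrite nabla_coordl// scaler_sumr; apply: eq_bigr => i _.
by rewrite scalerA [Y p 0 j * _]mulrC.
Qed.

Lemma riemann_op_tensorial_dir X Y Z p : smooth_vfield U X ->
  smooth_vfield U Y -> smooth_vfield U Z -> U p ->
  riemann_op nabla X Y Z p =
  \sum_i \sum_j (X p 0 i * Y p 0 j) *: riemann_op nabla (e_ i) (e_ j) Z p.
Proof.
move=> sX sY sZ Up.
rewrite /riemann_op !nabla2_coord// (nabla_coordl (smooth_lie_bracket sX sY))//.
under [X in - (_ - X)]eq_bigr do rewrite mxE scalerBl.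
have cancel_first (c c' a b : 'rV[R]_n.+1) : c + a - (c' + b) - (c - c') = a - b.
  by rewrite (opprD c') addrACA [c - c' + _]addrC addrK.
rewrite big_split/= sumrN cancel_first.
rewrite [X in - (_ - X)]exchange_big/= -sumrB -sumrN; apply: eq_bigr => i _.
rewrite -sumrB -sumrN; apply: eq_bigr => j _.
by rewrite -/(riemann_op _ _ _ _ _) riemann_op_coord// scalerN scalerBr [Y p 0 j * _]mulrC.
Qed.

(** The terms with one derivative of f are symmetric in i and j, and so is the
    one with two derivatives, by the symmetry of second partial derivatives. *)
Lemma riemann_op_scale i j f Z p : smooth_sfield U f -> smooth_vfield U Z ->
  U p -> riemann_op nabla (e_ i) (e_ j) (fun q => f q *: Z q) p =
         f p *: riemann_op nabla (e_ i) (e_ j) Z p.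
Proof.
move=> sf sZ Up.
have se := smooth_coord_vfield.
have half k l : nabla (e_ k) (nabla (e_ l) (fun q => f q *: Z q)) p =
    partial k (partial l f) p *: Z p
    + (partial l f p *: nabla (e_ k) Z p + partial k f p *: nabla (e_ l) Z p)
    + f p *: nabla (e_ k) (nabla (e_ l) Z) p.
  have E q : U q -> nabla (e_ l) (fun r => f r *: Z r) q =
      partial l f q *: Z q + f q *: nabla (e_ l) Z q.
    by move=> Uq; rewrite (nabla_leibniz cn sf)// vderiv_coord.
  have sdf := smooth_partial l sf.
  have sfZ := smooth_vfieldZ sf sZ.
  rewrite (nabla_extr E (se k) (nablaS (se l) sfZ) Up).
  rewrite (nablaDr cn (se k) (smooth_vfieldZ sdf sZ)
             (smooth_vfieldZ sf (nablaS (se l) sZ)) Up).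
  rewrite (nabla_leibniz cn sdf (se k) sZ Up).
  rewrite (nabla_leibniz cn sf (se k) (nablaS (se l) sZ) Up).
  by rewrite !vderiv_coord !addrA.
rewrite !riemann_op_coord//; last exact: smooth_vfieldZ.
rewrite !half (partial_comm oU i j sf Up) [partial j f p *: _ + _]addrC.
have cancel (a x y : 'rV[R]_n.+1) : a + x - (a + y) = x - y.
  by rewrite opprD addrACA subrr add0r.
by rewrite cancel scalerN scalerBr.
Qed.

Lemma riemann_opD i j Z W p : smooth_vfield U Z -> smooth_vfield U W ->
  U p -> riemann_op nabla (e_ i) (e_ j) (fun q => Z q + W q) p =
    riemann_op nabla (e_ i) (e_ j) Z p + riemann_op nabla (e_ i) (e_ j) W p.
Proof.
move=> sZ sW Up.
have se := smooth_coord_vfield.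
have half k l : nabla (e_ k) (nabla (e_ l) (fun q => Z q + W q)) p =
    nabla (e_ k) (nabla (e_ l) Z) p + nabla (e_ k) (nabla (e_ l) W) p.
  have E q : U q -> nabla (e_ l) (fun r => Z r + W r) q =
      nabla (e_ l) Z q + nabla (e_ l) W q.
    by move=> Uq; rewrite (nablaDr cn).
  rewrite (nabla_extr E (se k) (nablaS (se l) (smooth_vfieldD sZ sW)) Up).
  by rewrite (nablaDr cn)//; apply: nablaS.
rewrite !riemann_op_coord//; last exact: smooth_vfieldD.
by rewrite !half -opprD; congr (- _); rewrite opprD addrACA.
Qed.

Lemma riemann_op_tensorial_arg i j Z p : smooth_vfield U Z -> U p ->
  riemann_op nabla (e_ i) (e_ j) Z p =
  \sum_k Z p 0 k *: riemann_op nabla (e_ i) (e_ j) (e_ k) p.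
Proof.
move=> sZ Up; rewrite {1}(coord_expansion Z).
have se := smooth_coord_vfield.
elim: (index_enum _) => [|k r IHr].
  rewrite big_nil riemann_op_coord//; last first.
    by apply: smooth_vfield_ext smooth_vfield0 => q _; rewrite big_nil.
  have E : (fun q : point => \sum_(k <- [::]) Z q 0 k *: e_ k q) = fun=> 0.
    by apply/funext => q; rewrite big_nil.
  have E0 k l : nabla (e_ k) (nabla (e_ l) (fun=> 0)) p = 0.
    have E1 q : U q -> nabla (e_ l) (fun=> 0) q = 0 by exact: nabla0r.
    rewrite (nabla_extr E1 (se k) (nablaS (se l) smooth_vfield0) Up).
    exact: nabla0r.
  by rewrite E !E0 subrr oppr0.
under [X in riemann_op _ _ _ X]eq_fun do rewrite big_cons.
rewrite big_cons -IHr riemann_opD ?riemann_op_scale//.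
- by apply: smooth_vfieldZ.
- exact: smooth_combination.
Qed.

Definition christoffel l i j : sfield := fun q => nabla (e_ i) (e_ j) q 0 l.

Lemma riemann_op_christoffel i j k l p : U p ->
  riemann_op nabla (e_ i) (e_ j) (e_ k) p 0 l =
  - (partial i (christoffel l j k) p - partial j (christoffel l i k) p
     + \sum_m (christoffel m j k p * christoffel l i m p
               - christoffel m i k p * christoffel l j m p)).
Proof.
move=> Up.
have se := smooth_coord_vfield.
have half a b : nabla (e_ a) (nabla (e_ b) (e_ k)) p 0 l =
    partial a (christoffel l b k) p
    + \sum_m christoffel m b k p * christoffel l a m p.
  rewrite (coord_expansion (nabla (e_ b) (e_ k))).
  rewrite (nabla_combinationr (nablaS (se b) (se k)) se _ (se a) Up).
  rewrite summxE; under eq_bigr do rewrite !mxE vderiv_coord.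
  rewrite big_split/=; congr (_ + _).
  rewrite (bigD1 l)//= big1 ?addr0 => [|m ml]; first by rewrite eqxx mulr1.
  by rewrite eq_sym (negPf ml) mulr0.
rewrite riemann_op_coord// !mxE !half; congr (- _).
by rewrite opprD addrACA -sumrB.
Qed.

End VectorFields.

(** * Curvature of diagonal metrics *)

(** The one cancellation behind all the curvature conditions below. *)
Lemma sum_antisym (R : numDomainType) (I : finType) (c : I -> I -> R) :
  (forall i j, c i j = - c j i) -> \sum_i \sum_j c i j = 0.
Proof.
move=> cN; set S := \sum_i _.
suff /eqP : S + S = 0 by rewrite -mulr2n mulrn_eq0 => /eqP.
rewrite {2}/S exchange_big/= -big_split/= big1// => i _.
by rewrite -big_split/= big1// => j _; rewrite cN addNr.
Qed.

Lemma sum_kronecker (R : pzSemiRingType) (I : finType) (F : I -> R) i :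
  \sum_j F j * (i == j)%:R = F i.
Proof.
rewrite (bigD1 i)//= big1 ?addr0 => [|j ji]; first by rewrite eqxx mulr1.
by rewrite eq_sym (negPf ji) mulr0.
Qed.

Lemma sum2B (V : zmodType) (I : finType) (a b : I -> I -> V) :
  \sum_i \sum_j a i j - \sum_i \sum_j b i j = \sum_i \sum_j (a i j - b i j).
Proof. by rewrite -sumrB; apply: eq_bigr => i _; rewrite -sumrB. Qed.

Section Koszul.
Variables (R : realType) (n : nat) (U : set 'rV[R]_n.+1).
Variables (g : 'rV[R]_n.+1 -> 'M[R]_n.+1)
  (nabla : ('rV[R]_n.+1 -> 'rV[R]_n.+1) -> ('rV[R]_n.+1 -> 'rV[R]_n.+1) ->
           ('rV[R]_n.+1 -> 'rV[R]_n.+1)).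
Hypotheses (oU : open U) (lc : levi_civita U g nabla).
Hypothesis gT : forall p, (g p)^T = g p.
Local Notation e_ := (@coord_vfield R n).

Lemma metric_coord i j : metric g (e_ i) (e_ j) = fun p => g p i j.
Proof.
apply/funext => p; rewrite /metric /coord_vfield -rowE trmx_delta -colE !mxE.
by [].
Qed.

Lemma metricC X Y p : metric g X Y p = metric g Y X p.
Proof. by rewrite /metric -[in LHS]trace_mx11 -mxtrace_tr !trmx_mul gT trmxK mulmxA trace_mx11. Qed.

(** Each partial derivative of the metric is a sum of two values of
    [g(nabla_i e_j, e_k)], which is symmetric in i and j since coordinate fields
    commute; the alternating sum leaves a single one. *)
Lemma koszul i j k p : U p ->
  2 * metric g (nabla (e_ i) (e_ j)) (e_ k) p =
  partial i (fun q => g q j k) p + partial j (fun q => g q i k) p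
  - partial k (fun q => g q i j) p.
Proof.
move=> Up; have se := smooth_coord_vfield oU.
have dg a b c : partial a (fun q => g q b c) p =
    metric g (nabla (e_ a) (e_ b)) (e_ c) p
    + metric g (nabla (e_ a) (e_ c)) (e_ b) p.
  rewrite -metric_coord -vderiv_coord.
  by rewrite (levi_civita_metric lc (se a) (se b) (se c) Up) (metricC (e_ b)).
have sym a b c : metric g (nabla (e_ a) (e_ b)) (e_ c) p =
    metric g (nabla (e_ b) (e_ a)) (e_ c) p.
  rewrite /metric; congr ((_ *m _ *m _) _ _); apply/eqP; rewrite -subr_eq0.
  by rewrite (levi_civita_torsion_free lc (se a) (se b) Up) lie_bracket_coord.
rewrite !dg (sym j i k) (sym k i j) (sym k j i).
by move: (metric _ _ _ _) (metric _ _ _ _) (metric _ _ _ _) => a b c; ring.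
Qed.

End Koszul.

Section DiagonalMetric.
Variables (R : realType) (n : nat) (U : set 'rV[R]_n.+1).
Notation point := 'rV[R]_n.+1.
Notation sfield := (point -> R).
Notation vfield := (point -> 'rV[R]_n.+1).
Variables (G : 'I_n.+1 -> sfield) (g : point -> 'M[R]_n.+1).
Hypotheses (oU : open U) (gE : forall p, g p = diag_mx (\row_i G i p)).
Hypotheses (sG : forall i, smooth_sfield U (G i))
           (G0 : forall i p, U p -> G i p != 0).
Local Notation e_ := (@coord_vfield R n).
Implicit Types (X Y Z W : vfield) (p : point).

Lemma metric_diag X Y p :
  metric g X Y p = \sum_i G i p * X p 0 i * Y p 0 i.
Proof.
rewrite /metric gE mxE; apply: eq_bigr => i _.
by rewrite mul_mx_diag !mxE; congr (_ * _); exact: mulrC.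
Qed.

Lemma metric_dual_diag B Y p i : U p ->
  metric_dual g B Y p 0 i = B (e_ i) Y p / G i p.
Proof.
move=> Up; rewrite /metric_dual gE.
set D := diag_mx _; set v := \row_j _.
have uD : D \in unitmx.
  rewrite unitmxE det_diag unitfE; apply/prodf_neq0 => j _.
  by rewrite mxE G0.
have -> : v = (\row_j (v 0 j / G j p)) *m D.
  by rewrite mul_mx_diag; apply/rowP => j; rewrite !mxE divfK ?G0.
by rewrite mulmxK// !mxE.
Qed.

Lemma smooth_metric X Y : smooth_vfield U X -> smooth_vfield U Y ->
  smooth_sfield U (metric g X Y).
Proof.
move=> sX sY; have s i := smoothM oU (smoothM oU (sG i) (sX i)) (sY i).
by apply: (smooth_ext oU) (smooth_sum oU _ s) => q _; rewrite metric_diag.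
Qed.

Lemma smooth_wedge X Y Z : smooth_vfield U X -> smooth_vfield U Y ->
  smooth_vfield U Z -> smooth_vfield U (wedge g X Y Z).
Proof.
by move=> sX sY sZ; apply: smooth_vfieldB => //; apply: smooth_vfieldZ => //;
  apply: smooth_metric.
Qed.

Lemma smooth_metric_dual B Y : (forall i, smooth_sfield U (B (e_ i) Y)) ->
  smooth_vfield U (metric_dual g B Y).
Proof.
move=> sB i; have s := smoothM oU (sB i) (smoothV oU (sG i) (@G0 i)).
by apply: (smooth_ext oU) s => q Uq; rewrite metric_dual_diag.
Qed.

(** The operator sum_ij K_ij X_i Y_j (e_i wedge e_j), in components: the sign
    convention is that of [wedge], for which all the K_ij are 1. *)
Definition sectional (K : point -> 'I_n.+1 -> 'I_n.+1 -> R)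
    (D : vfield -> vfield -> vfield -> vfield) :=
  forall X Y Z, smooth_vfield U X -> smooth_vfield U Y -> smooth_vfield U Z ->
  forall p, U p -> forall l, D X Y Z p 0 l =
  \sum_m K p l m * G m p * Z p 0 m
         * (X p 0 l * Y p 0 m - X p 0 m * Y p 0 l).

(** The tensor whose eigenvalues with respect to the metric are the t_i, with the
    coordinate fields as eigenvectors. *)
Definition diagonal_form (t : 'I_n.+1 -> sfield) (T : vfield -> vfield -> sfield) :=
  forall X Y, smooth_vfield U X -> smooth_vfield U Y -> forall p, U p ->
  T X Y p = \sum_i t i p * G i p * X p 0 i * Y p 0 i.

Definition smooth_op (D : vfield -> vfield -> vfield -> vfield) :=
  forall X Y Z, smooth_vfield U X -> smooth_vfield U Y -> smooth_vfield U Z ->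
  smooth_vfield U (D X Y Z).

Lemma wedgeE X Y Z p l : wedge g X Y Z p 0 l =
  \sum_m G m p * Z p 0 m * (X p 0 l * Y p 0 m - X p 0 m * Y p 0 l).
Proof.
rewrite !mxE !metric_diag !mulr_suml -sumrB; apply: eq_bigr => m _.
by ring.
Qed.

Lemma sectional_wedge : sectional (fun _ _ _ => 1) (wedge g).
Proof.
move=> X Y Z _ _ _ p _ l; rewrite wedgeE.
by apply: eq_bigr => m _; rewrite mul1r.
Qed.

Lemma form_coordl t T i X p : diagonal_form t T -> smooth_vfield U X -> U p ->
  T (e_ i) X p = t i p * G i p * X p 0 i.
Proof.
move=> tT sX Up; rewrite tT//; last exact: smooth_coord_vfield.
rewrite -(sum_kronecker (fun j => t j p * G j p * X p 0 j) i).
apply: eq_bigr => j _; rewrite /coord_vfield mxE eqxx/= eq_sym.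
by ring.
Qed.

Section FormAndOperator.
Variables (K : point -> 'I_n.+1 -> 'I_n.+1 -> R) (t : 'I_n.+1 -> sfield).
Variables (D : vfield -> vfield -> vfield -> vfield) (T : vfield -> vfield -> sfield).
Hypotheses (KD : sectional K D) (tT : diagonal_form t T) (sD : smooth_op D).

(** Apart from the factor t_l K_lm, the summand is antisymmetric in (l, m). *)
Lemma tensor_dot_diag W Z X Y p : smooth_vfield U W -> smooth_vfield U Z ->
  smooth_vfield U X -> smooth_vfield U Y -> U p ->
  tensor_dot D T W Z X Y p =
  \sum_l \sum_m - (t l p * K p l m * G l p * G m p
     * (X p 0 l * Y p 0 m - X p 0 m * Y p 0 l)
     * (W p 0 l * Z p 0 m + W p 0 m * Z p 0 l)).
Proof.
move=> sW sZ sX sY Up; rewrite /tensor_dot !tT//; try exact: sD.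
rewrite -opprD -big_split/= -sumrN; apply: eq_bigr => l _.
rewrite !KD// sumrN; congr (- _).
rewrite mulr_sumr mulr_suml mulr_sumr -big_split/=; apply: eq_bigr => m _.
by ring.
Qed.

Hypothesis Ksym : forall p l m, U p -> K p l m = K p m l.

Hypothesis sT : forall X Y, smooth_vfield U X -> smooth_vfield U Y ->
  smooth_sfield U (T X Y).

(** Summing the three cyclic terms, the coefficient of K_lm G_l G_m is
    t_l X_m P_lm - t_m X_l P_ml, where P_lm is the sum of the products of two of
    W_l, Y_l, Z_l by the remaining one of W_m, Y_m, Z_m; this is antisymmetric in
    (l, m), while K_lm G_l G_m is symmetric. *)
Lemma compatible_diag : compatible U g D T.
Proof.
have se := smooth_coord_vfield oU.
have A_diag W p i : smooth_vfield U W -> U p ->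
    metric_dual g (fun Z W => T W Z) W p 0 i = t i p * W p 0 i.
  move=> sW Up; rewrite metric_dual_diag// tT//.
  under eq_bigr => j _ do rewrite /coord_vfield mxE eqxx/= [j == i]eq_sym.
  by rewrite (sum_kronecker (fun j => t j p * G j p * W p 0 j)) mulrAC mulfK ?G0.
have sA W : smooth_vfield U W ->
    smooth_vfield U (metric_dual g (fun Z W => T W Z) W).
  by move=> sW; apply: smooth_metric_dual => i; apply: sT.
have DA W X Y Z p : smooth_vfield U W -> smooth_vfield U X ->
    smooth_vfield U Y -> smooth_vfield U Z -> U p ->
    tensor04 g D (metric_dual g (fun Z W => T W Z) W) X Y Z p =
    \sum_l \sum_m K p l m * G l p * G m p * Y p 0 m * Z p 0 l
      * (t l p * W p 0 l * X p 0 m - t m p * W p 0 m * X p 0 l).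
  move=> sW sX sY sZ Up; rewrite /tensor04 metric_diag.
  apply: eq_bigr => l _; rewrite (KD (sA _ sW))// mulr_sumr mulr_suml.
  apply: eq_bigr => m _; rewrite !A_diag//.
  by move: (t l p) (t m p) (K p l m) (G l p) (G m p) => *; ring.
move=> /= W Y Z X sW sY sZ sX p Up; rewrite !DA// -!big_split/=.
under eq_bigr do rewrite -!big_split/=.
apply: sum_antisym => l m; rewrite (Ksym m l Up).
move: (t l p) (t m p) (K p l m) (G l p) (G m p) => tl tm k gl gm.
move: (X p 0 l) (X p 0 m) (Y p 0 l) (Y p 0 m) => xl xm yl ym.
by move: (W p 0 l) (W p 0 m) (Z p 0 l) (Z p 0 m) => wl wm zl zm; ring.
Qed.

End FormAndOperator.

(** The summands of the two sides at (l, m) and at (m, l) differ in total by a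
    multiple of (t_l - t_m) (K_lm - b). *)
Lemma tensor_dot_tachibana K t D T b W Z X Y p :
  sectional K D -> smooth_op D -> diagonal_form t T ->
  (forall p l m, U p -> K p l m = K p m l) ->
  (forall l m, (t l p - t m p) * (K p l m - b) = 0) ->
  smooth_vfield U W -> smooth_vfield U Z ->
  smooth_vfield U X -> smooth_vfield U Y -> U p ->
  tensor_dot D T W Z X Y p = b * tachibana g T W Z X Y p.
Proof.
move=> KD sD tT Ksym tK sW sZ sX sY Up.
rewrite (tensor_dot_diag KD tT sD)//.
rewrite /tachibana (tensor_dot_diag sectional_wedge tT smooth_wedge)// mulr_sumr.
under [RHS]eq_bigr do rewrite mulr_sumr.
apply/eqP; rewrite -subr_eq0 sum2B; apply/eqP/sum_antisym => l m.
have := tK l m; rewrite (Ksym p m l Up).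
move: (t l p) (t m p) (K p l m) (G l p) (G m p) => tl tm k gl gm.
move: (X p 0 l) (X p 0 m) (Y p 0 l) (Y p 0 m) => xl xm yl ym.
move: (W p 0 l) (W p 0 m) (Z p 0 l) (Z p 0 m) => wl wm zl zm {}tK.
apply/eqP; rewrite -subr_eq0 opprK; apply/eqP.
transitivity (- ((tl - tm) * (k - b)) * (gl * gm * (xl * ym - xm * yl)
  * (wl * zm + wm * zl))); first by ring.
by rewrite tK oppr0 mul0r.
Qed.

Variable nabla : vfield -> vfield -> vfield.
Hypothesis lc : levi_civita U g nabla.
Let cn := levi_civita_connection lc.

Lemma christoffel_diag k i j p : U p ->
  christoffel nabla k i j p =
  ((j == k)%:R * partial i (G j) p + (i == k)%:R * partial j (G i) p
   - (i == j)%:R * partial k (G i) p) / (2 * G k p).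
Proof.
move=> Up.
have gT q : (g q)^T = g q by rewrite gE tr_diag_mx.
have pg a b c : partial a (fun q => g q b c) p = (b == c)%:R * partial a (G b) p.
  have [->|bc] := eqVneq b c.
    rewrite mul1r; apply: (partial_ext oU) Up => q _.
    by rewrite gE !mxE eqxx.
  rewrite mul0r -(partial_cst a 0 p); apply: (partial_ext oU) Up => q _.
  by rewrite gE !mxE (negPf bc).
have := koszul oU lc gT i j k Up; rewrite !pg => <-.
rewrite metric_diag (bigD1 k)//= big1 ?addr0 => [|m mk]; last first.
  by rewrite /coord_vfield mxE (negPf mk) andbF mulr0.
rewrite /coord_vfield mxE !eqxx mulr1 -/(christoffel nabla k i j p).
by rewrite mulrA mulrAC mulfV ?mul1r// mulf_neq0 ?G0// pnatr_eq0.
Qed.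

Lemma sectional_riemann K :
  (forall p i j k l, U p ->
     riemann_op nabla (e_ i) (e_ j) (e_ k) p 0 l =
     K p i j * G k p * ((j == k)%:R * (i == l)%:R - (i == k)%:R * (j == l)%:R)) ->
  (forall p l m, U p -> K p l m = K p m l) ->
  sectional K (riemann_op nabla).
Proof.
move=> RK Ksym X Y Z sX sY sZ p Up l.
have RZ i j : riemann_op nabla (e_ i) (e_ j) Z p 0 l =
    K p i j * G j p * Z p 0 j * (l == i)%:R
    - K p i j * G i p * Z p 0 i * (l == j)%:R.
  rewrite (riemann_op_tensorial_arg oU cn _ _ sZ Up) summxE.
  rewrite -(sum_kronecker (fun k => K p i j * G k p * Z p 0 k * (l == i)%:R) j).
  rewrite -(sum_kronecker (fun k => K p i j * G k p * Z p 0 k * (l == j)%:R) i).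
  rewrite -sumrB; apply: eq_bigr => k _; rewrite mxE RK//.
  by rewrite ![_ == l]eq_sym; ring.
rewrite (riemann_op_tensorial_dir oU cn sX sY sZ Up) summxE.
under eq_bigr do (rewrite summxE; under eq_bigr do rewrite mxE RZ mulrBr).
under eq_bigr do rewrite sumrB.
rewrite sumrB.
under [RHS]eq_bigr do rewrite mulrBr.
rewrite [RHS]sumrB; congr (_ - _).
  rewrite exchange_big/=; apply: eq_bigr => m _.
  rewrite -(sum_kronecker (fun i => K p i m * G m p * Z p 0 m * (X p 0 i * Y p 0 m)) l).
  by apply: eq_bigr => i _; ring.
apply: eq_bigr => m _; rewrite (Ksym p l m Up).
rewrite -(sum_kronecker (fun j => K p m j * G m p * Z p 0 m * (X p 0 m * Y p 0 j)) l).
by apply: eq_bigr => i _; ring.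
Qed.

Section Curvature.
Variable K : point -> 'I_n.+1 -> 'I_n.+1 -> R.
Hypotheses (KR : sectional K (riemann_op nabla))
  (Ksym : forall p l m, U p -> K p l m = K p m l)
  (Kdiag : forall p l, U p -> K p l l = 0).

(** The entries K_ii, which multiply e_i wedge e_i = 0, are normalized to 0, so
    that the sum may run over all directions. *)
Definition ricci_eigenvalue i p := \sum_j K p i j.
Local Notation s_ := ricci_eigenvalue.

Lemma ricci_diag : diagonal_form s_ (ricci nabla).
Proof.
move=> X Y sX sY p Up; rewrite /ricci /vtrace.
have se := smooth_coord_vfield oU.
under eq_bigr do rewrite KR//.
rewrite exchange_big/=; apply: eq_bigr => m _.
rewrite /ricci_eigenvalue !mulr_suml.
rewrite (bigD1 m)//= [RHS](bigD1 m)//= (Kdiag m Up) !mul0r; congr (_ + _).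
apply: eq_bigr => l lm; rewrite (Ksym m l Up) /coord_vfield !mxE !eqxx.
by rewrite [m == l]eq_sym (negPf lm)/=; ring.
Qed.

Lemma smooth_vtrace (A : vfield -> vfield) :
  (forall i, smooth_vfield U (A (e_ i))) -> smooth_sfield U (vtrace A).
Proof. by move=> sA; apply: smooth_sum => // i; apply: sA. Qed.

Lemma smooth_ricci X Y : smooth_vfield U X -> smooth_vfield U Y ->
  smooth_sfield U (ricci nabla X Y).
Proof.
move=> sX sY; apply: smooth_vtrace => i.
by apply: smooth_riemann_op => //; apply: smooth_coord_vfield.
Qed.

Lemma smooth_ricci_op X : smooth_vfield U X -> smooth_vfield U (ricci_op g nabla X).
Proof.
move=> sX; apply: smooth_metric_dual => i.
by apply: smooth_ricci => //; apply: smooth_coord_vfield.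
Qed.

Lemma smooth_scalar_curvature : smooth_sfield U (scalar_curvature g nabla).
Proof.
by apply: smooth_vtrace => i; apply: smooth_ricci_op; apply: smooth_coord_vfield.
Qed.

Lemma ricci_op_diag X p i : smooth_vfield U X -> U p ->
  ricci_op g nabla X p 0 i = s_ i p * X p 0 i.
Proof.
move=> sX Up; rewrite metric_dual_diag// (form_coordl _ ricci_diag)//.
by rewrite mulrAC mulfK ?G0.
Qed.

Lemma scalar_curvature_diag p : U p -> scalar_curvature g nabla p = \sum_i s_ i p.
Proof.
move=> Up; apply: eq_bigr => i _; rewrite ricci_op_diag//.
  by rewrite /coord_vfield mxE !eqxx mulr1.
exact: smooth_coord_vfield.
Qed.

Definition weyl_eigenvalue p l m := K p l m
  - (n.+1%:R - 2)^-1 * (s_ l p + s_ m p)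
  + (\sum_i s_ i p) / ((n.+1%:R - 1) * (n.+1%:R - 2)).

(** Since the Ricci operator scales e_l by s_l, the correction terms of the Weyl
    operator are multiples of the same bivectors e_l wedge e_m. *)
Lemma sectional_weyl : sectional weyl_eigenvalue (weyl_op g nabla).
Proof.
move=> X Y Z sX sY sZ p Up l.
have comp (a b c d : 'rV[R]_n.+1) x y : (a - x *: (b + c) + y *: d) 0 l =
    a 0 l - x * (b 0 l + c 0 l) + y * d 0 l by rewrite !mxE.
rewrite /weyl_op comp KR// !wedgeE scalar_curvature_diag// -big_split/=.
rewrite !mulr_sumr -sumrB -big_split/=; apply: eq_bigr => m _.
rewrite !ricci_op_diag// /weyl_eigenvalue.
by set k := _ / _; set c := (_ - 2)^-1; move: k c => k c; ring.
Qed.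

Definition energy_momentum_eigenvalue Lambda i p :=
  s_ i p - (\sum_j s_ j p) / 2 + Lambda.

Lemma energy_momentum_diag Lambda :
  diagonal_form (energy_momentum_eigenvalue Lambda)
                (energy_momentum g nabla Lambda).
Proof.
move=> X Y sX sY p Up.
rewrite /energy_momentum ricci_diag// scalar_curvature_diag// metric_diag.
rewrite !mulr_sumr -sumrB -big_split/=; apply: eq_bigr => i _.
by rewrite /energy_momentum_eigenvalue; move: (\sum_j _) => k; ring.
Qed.

Lemma smooth_energy_momentum Lambda X Y :
  smooth_vfield U X -> smooth_vfield U Y ->
  smooth_sfield U (energy_momentum g nabla Lambda X Y).
Proof.
move=> sX sY.
have sg := smooth_metric sX sY.
apply: (smoothD oU); last exact: smoothZ.
apply: (smoothB oU); first exact: smooth_ricci.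
apply: (smoothM oU) => //; apply: (smoothM oU) (smooth_cst oU _).
exact: smooth_scalar_curvature.
Qed.

Lemma smooth_weyl_op : smooth_op (weyl_op g nabla).
Proof.
move=> X Y Z sX sY sZ; rewrite /weyl_op.
have sJ := smooth_ricci_op; have sw := smooth_wedge.
apply: smooth_vfieldD => //.
  apply: smooth_vfieldB => //; first exact: smooth_riemann_op.
  apply: smooth_vfieldZ => //; first exact: smooth_cst.
  by apply: smooth_vfieldD => //; apply: sw => //; apply: sJ.
apply: smooth_vfieldZ => //; last exact: sw.
by apply: (smoothM oU) (smooth_cst oU _); exact: smooth_scalar_curvature.
Qed.

End Curvature.
End DiagonalMetric.

(** * Static spherically symmetric metrics *)

Section Tables.
Variable R : numFieldType.

(** Each Christoffel symbol of a static metric is a function of rho times a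
    function of theta.  They are tabulated as functions of the values f, f1, f2
    of F, F', F'' at rho = r, and of s = sin theta and c = cos theta, so that the
    curvature is computed by identities between rational functions. *)
Definition christoffel_radial (f f1 r : R) (l i j : nat) : R :=
  match l, i, j with
  | 0, 0, 1 | 0, 1, 0 => (f1 / (2 * f))%R
  | 1, 0, 0 => (f * f1 / 2)%R
  | 1, 1, 1 => (- (f1 / (2 * f)))%R
  | 1, 2, 2 | 1, 3, 3 => (- (r * f))%R
  | 2, 1, 2 | 2, 2, 1 | 3, 1, 3 | 3, 3, 1 => (r^-1)%R
  | 2, 3, 3 | 3, 2, 3 | 3, 3, 2 => (1)%R
  | _, _, _ => (0)%R
  end%N.

Definition christoffel_radial' (f f1 f2 r : R) (l i j : nat) : R :=
  match l, i, j with
  | 0, 0, 1 | 0, 1, 0 => (f2 / (2 * f) - f1 ^+ 2 / (2 * f ^+ 2))%R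
  | 1, 0, 0 => ((f1 ^+ 2 + f * f2) / 2)%R
  | 1, 1, 1 => (- (f2 / (2 * f) - f1 ^+ 2 / (2 * f ^+ 2)))%R
  | 1, 2, 2 | 1, 3, 3 => (- (f + r * f1))%R
  | 2, 1, 2 | 2, 2, 1 | 3, 1, 3 | 3, 3, 1 => (- r ^- 2)%R
  | _, _, _ => (0)%R
  end%N.

Definition christoffel_angular (s c : R) (l i j : nat) : R :=
  match l, i, j with
  | 1, 3, 3 => (s ^+ 2)%R
  | 2, 3, 3 => (- (s * c))%R
  | 3, 2, 3 | 3, 3, 2 => (c / s)%R
  | _, _, _ => (1)%R
  end%N.

(** The derivative of the cotangent is written -(1 + cot^2), so that s and c are
    independent variables in the curvature identities. *)
Definition christoffel_angular' (s c : R) (l i j : nat) : R :=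
  match l, i, j with
  | 1, 3, 3 => (2 * s * c)%R
  | 2, 3, 3 => (s ^+ 2 - c ^+ 2)%R
  | 3, 2, 3 | 3, 3, 2 => (- (1 + (c / s) ^+ 2))%R
  | _, _, _ => (0)%R
  end%N.

Definition christoffel_entry (f f1 r s c : R) (l i j : nat) : R :=
  christoffel_radial f f1 r l i j * christoffel_angular s c l i j.

Definition christoffel_entry_partial (f f1 f2 r s c : R) (m l i j : nat) : R :=
  match m with
  | 1 => (christoffel_radial' f f1 f2 r l i j * christoffel_angular s c l i j)%R
  | 2 => (christoffel_radial f f1 r l i j * christoffel_angular' s c l i j)%R
  | _ => 0%R
  end%N.

Definition metric_entry (f r s : R) (i : nat) : R :=
  match i with
  | 0 => (- f)%R | 1 => (f^-1)%R | 2 => (r ^+ 2)%R | _ => (r ^+ 2 * s ^+ 2)%R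
  end%N.

Definition metric_entry_partial (f f1 r s c : R) (m i : nat) : R :=
  match m, i with
  | 1, 0 => (- f1)%R | 1, 1 => (- (f1 / f ^+ 2))%R
  | 1, 2 => (2 * r)%R | 1, 3 => (2 * r * s ^+ 2)%R | 2, 3 => (r ^+ 2 * (2 * s * c))%R
  | _, _ => (0)%R
  end%N.

(** The value a on the plane (t, rho), c on the plane (theta, phi), and b on the
    planes that meet both blocks {t, rho} and {theta, phi}. *)
Definition block_curvature (a b c : R) (i j : nat) : R :=
  match i, j with
  | 0, 1 | 1, 0 => (a)%R
  | 0, 2 | 0, 3 | 1, 2 | 1, 3 | 2, 0 | 3, 0 | 2, 1 | 3, 1 => (b)%R
  | 2, 3 | 3, 2 => (c)%R
  | _, _ => (0)%R
  end%N.

(** The Ricci eigenvalue is a + 2 b on {t, rho} and c + 2 b on {theta, phi}, so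
    that it separates l from m only on mixed planes, where the curvature is b. *)
Lemma block_ricci_mixed (a b c : R) (l m : nat) : (l < 4)%N -> (m < 4)%N ->
  (\sum_(j < 4) block_curvature a b c l j - \sum_(j < 4) block_curvature a b c m j)
  * (block_curvature a b c l m - b) = 0.
Proof.
rewrite !big_ord_recl !big_ord0 /= /bump /=.
by case: l => [|[|[|[|l]]]] // _; case: m => [|[|[|[|m]]]] // _ /=; ring.
Qed.

(** The trace-free part of the curvature takes the value (2 b - a - c) / 6 on
    mixed planes. *)
Lemma block_weyl_mixed (a b c : R) (l m : nat) : (l < 4)%N -> (m < 4)%N ->
  let s i := \sum_(j < 4) block_curvature a b c i j in
  (s l - s m) * (block_curvature a b c l m - (4%:R - 2)^-1 * (s l + s m)
    + (\sum_(i < 4) s i) / ((4%:R - 1) * (4%:R - 2)) - (2 * b - a - c) / 6) = 0.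
Proof.
move=> /=; rewrite !big_ord_recl !big_ord0 /= /bump /=.
by case: l => [|[|[|[|l]]]] // _; case: m => [|[|[|[|m]]]] // _ /=; field.
Qed.

Section Identities.
Variables f f1 f2 r s c : R.
Hypotheses (f0 : f != 0) (r0 : r != 0) (s0 : s != 0).

Local Notation gam l i j := (christoffel_entry f f1 r s c l i j).
Local Notation dgam m l i j := (christoffel_entry_partial f f1 f2 r s c m l i j).

Lemma christoffel_entryE (k i j : nat) : (k < 4)%N -> (i < 4)%N -> (j < 4)%N ->
  ((j == k)%:R * metric_entry_partial f f1 r s c i j
   + (i == k)%:R * metric_entry_partial f f1 r s c j i
   - (i == j)%:R * metric_entry_partial f f1 r s c k i) / (2 * metric_entry f r s k)
  = gam k i j.
Proof.
case: k => [|[|[|[|k]]]] // _; case: i => [|[|[|[|i]]]] // _;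
case: j => [|[|[|[|j]]]] // _; rewrite /christoffel_entry /=; field; by rewrite ?f0 ?r0 ?s0.
Qed.

Lemma riemann_entryE (i j k l : nat) :
  (i < 4)%N -> (j < 4)%N -> (k < 4)%N -> (l < 4)%N ->
  - (dgam i l j k - dgam j l i k
     + \sum_(m < 4) (gam m j k * gam l i m - gam m i k * gam l j m))
  = block_curvature (f2 / 2) (f1 / (2 * r)) ((f - 1) / r ^+ 2) i j
    * metric_entry f r s k
    * ((j == k)%:R * (i == l)%:R - (i == k)%:R * (j == l)%:R).
Proof.
rewrite !big_ord_recl big_ord0 /= /bump /=.
case: i => [|[|[|[|i]]]] // _; case: j => [|[|[|[|j]]]] // _;
case: k => [|[|[|[|k]]]] // _; case: l => [|[|[|[|l]]]] // _;
rewrite /christoffel_entry /christoffel_entry_partial /=.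
all: field.
all: rewrite ?f0 ?r0 ?s0 //.
Qed.
End Identities.
End Tables.

Section StaticMetric.
Variables (R : realType) (U : set 'rV[R]_4) (F F1 F2 : R -> R).
Notation point := 'rV[R]_4.
Notation vfield := (point -> 'rV[R]_4).
Hypotheses (oU : open U)
  (dF : forall p, U p -> is_derive (rho p) 1 F (F1 (rho p)))
  (dF1 : forall p, U p -> is_derive (rho p) 1 F1 (F2 (rho p)))
  (sF : smooth_sfield U (fun p => F (rho p)))
  (F0 : forall p, U p -> F (rho p) != 0)
  (r0 : forall p, U p -> rho p != 0)
  (s0 : forall p, U p -> sin (theta p) != 0).
Local Notation e_ := (@coord_vfield R 3).

Let G (i : 'I_4) (p : point) := metric_entry (F (rho p)) (rho p) (sin (theta p)) i.

Let smooth_rho : smooth_sfield U (@rho R).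
Proof. exact: smooth_coordinate. Qed.

Let smooth_theta : smooth_sfield U (@theta R).
Proof. exact: smooth_coordinate. Qed.

Let partial_rho m p : partial m (@rho R) p = (m == 1%N :> nat)%:R.
Proof. by rewrite partial_coordinate. Qed.

Let partial_theta m p : partial m (@theta R) p = (m == 2%N :> nat)%:R.
Proof. by rewrite partial_coordinate. Qed.

Lemma smooth_static_coef i : smooth_sfield U (G i).
Proof.
have sr2 := smoothX oU 2 smooth_rho.
have [ss _] := smooth_sin_cos oU smooth_theta.
rewrite /G; case: i => [[|[|[|[|i]]]] hi] //=.
- exact: smoothN.
- exact: smoothV.
- exact: (smoothM oU sr2 (smoothX oU 2 ss)).
Qed.

Lemma static_coef_neq0 i p : U p -> G i p != 0.
Proof.
move=> Up; have f0 := F0 Up; have rr0 := r0 Up; have ss0 := s0 Up.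
rewrite /G; case: i => [[|[|[|[|i]]]] hi] //=.
- by rewrite oppr_eq0.
- by rewrite invr_eq0.
- by rewrite expf_neq0.
- by rewrite mulf_neq0// expf_neq0.
Qed.

Lemma partial_rad_ang (A B : R -> R) (A' B' : R) m p : U p ->
  is_derive (rho p) 1 A A' -> is_derive (theta p) 1 B B' ->
  partial m (fun q => A (rho q) * B (theta q)) p =
  match nat_of_ord m with
  | 1%N => A' * B (theta p) | 2%N => A (rho p) * B' | _ => 0
  end.
Proof.
move=> Up dA dB.
have dr := is_derive_comp_dir dA (derivableP (smooth_derivable (i := m) smooth_rho Up)).
have dt := is_derive_comp_dir dB (derivableP (smooth_derivable (i := m) smooth_theta Up)).
have d := is_deriveM dr dt.
rewrite [LHS](@derive_val _ _ _ _ _ _ _ d) -!/(partial _ _ _).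
rewrite partial_rho partial_theta.
case: m {dr dt d} => [[|[|[|[|m]]]] hm] //=;
  rewrite ?(mulr0, mulr1, scaler0, addr0, add0r)//.
exact: mulrC.
Qed.

Lemma is_derive_christoffel_radial l i j p : U p ->
  is_derive (rho p) 1 (fun x => christoffel_radial (F x) (F1 x) x l i j)
    (christoffel_radial' (F (rho p)) (F1 (rho p)) (F2 (rho p)) (rho p) l i j).
Proof.
move=> Up; have f0 := F0 Up; have rr0 := r0 Up.
have d := dF Up; have d1 := dF1 Up.
set x := rho p in f0 rr0 d d1 *.
have dcst (c : R) : is_derive x 1 (fun=> c : R) 0 by exact: is_derive_cst.
have dquot : is_derive x 1 (fun x => F1 x / (2 * F x))
    (F2 x / (2 * F x) - F1 x ^+ 2 / (2 * F x ^+ 2)).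
  have n0 : 2 * F x != 0 by rewrite mulf_neq0.
  have d2 := @is_deriveV R (fun x => 2 * F x) x _ _ n0 (is_deriveM (dcst 2) d).
  apply: (is_derive_eq (is_deriveM d1 d2)).
  rewrite /GRing.scale/=; move: f0; move: (F x) (F1 x) (F2 x) => f f1 f2 f0.
  by field.
have dprod : is_derive x 1 (fun x => F x * F1 x / 2) ((F1 x ^+ 2 + F x * F2 x) / 2).
  apply: (is_derive_eq (is_deriveM (is_deriveM d d1) (dcst 2^-1))).
  rewrite /GRing.scale/= /GRing.mul_fun/=.
  by move: (F x) (F1 x) (F2 x) => f f1 f2; field.
have drf : is_derive x 1 (fun x => - (x * F x)) (- (F x + x * F1 x)).
  apply: (is_derive_eq (is_deriveN (is_deriveM (is_derive_id x 1) d))).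
  by rewrite /GRing.scale/= mulr1 addrC.
have drV : is_derive x 1 (fun x => x^-1) (- x ^- 2).
  by apply: (is_derive_eq (is_deriveV rr0 (is_derive_id x 1))); rewrite [LHS]mulr1.
have dquotN := is_deriveN dquot.
case: l => [|[|[|[|l]]]]; case: i => [|[|[|[|i]]]]; case: j => [|[|[|[|j]]]];
  rewrite /=; by [exact: dcst|exact: dquot|exact: dprod|exact: dquotN|exact: drf
  |exact: drV].
Qed.

Lemma is_derive_christoffel_angular l i j p : U p ->
  is_derive (theta p) 1 (fun x => christoffel_angular (sin x) (cos x) l i j)
    (christoffel_angular' (sin (theta p)) (cos (theta p)) l i j).
Proof.
move=> Up; have ss0 := s0 Up; set x := theta p in ss0 *.
have dcst (c : R) : is_derive x 1 (fun=> c : R) 0 by exact: is_derive_cst.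
have ds := is_derive_sin x; have dc := is_derive_cos x.
have ds2 : is_derive x 1 (fun x => sin x ^+ 2) (2 * sin x * cos x).
  by apply: (is_derive_eq (is_deriveX 2 ds)); rewrite /GRing.scale/=; ring.
have dsc : is_derive x 1 (fun x => - (sin x * cos x)) (sin x ^+ 2 - cos x ^+ 2).
  apply: (is_derive_eq (is_deriveN (is_deriveM ds dc))).
  by rewrite /GRing.scale/=; ring.
have dcot : is_derive x 1 (fun x => cos x / sin x) (- (1 + (cos x / sin x) ^+ 2)).
  apply: (is_derive_eq (is_deriveM dc (is_deriveV ss0 ds))).
  by rewrite /GRing.scale/=; field.
case: l => [|[|[|[|l]]]]; case: i => [|[|[|[|i]]]]; case: j => [|[|[|[|j]]]];
  rewrite /=; by [exact: dcst|exact: ds2|exact: dsc|exact: dcot].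
Qed.

Variable g : point -> 'M[R]_4.
Hypothesis gE : forall p, g p = diag_mx (\row_i G i p).
Variable nabla : vfield -> vfield -> vfield.
Hypothesis lc : levi_civita U g nabla.
Let cn := levi_civita_connection lc.

Lemma partial_static_coef m i p : U p -> partial m (G i) p =
  metric_entry_partial (F (rho p)) (F1 (rho p)) (rho p) (sin (theta p)) (cos (theta p)) m i.
Proof.
move=> Up; have f0 := F0 Up; have rr0 := r0 Up.
have d := dF Up.
have d1 : is_derive (theta p) 1 (fun=> 1 : R) 0 by exact: is_derive_cst.
have dx2 : is_derive (rho p) 1 (fun x => x ^+ 2) (2 * rho p).
  apply: (is_derive_eq (is_deriveX 2 (is_derive_id (rho p) 1))).
  by rewrite /GRing.scale/= mulr1.
have ds2 : is_derive (theta p) 1 (fun x => sin x ^+ 2)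
   (2 * sin (theta p) * cos (theta p)).
  apply: (is_derive_eq (is_deriveX 2 (is_derive_sin (theta p)))).
  by rewrite /GRing.scale/=; ring.
have GE (A B : R -> R) A' B' : (forall q, G i q = A (rho q) * B (theta q)) ->
    is_derive (rho p) 1 A A' -> is_derive (theta p) 1 B B' ->
    partial m (G i) p =   match nat_of_ord m with
  | 1%N => A' * B (theta p) | 2%N => A (rho p) * B' | _ => 0
  end.
  by move=> GAB dA dB; rewrite (funext GAB); apply: partial_rad_ang.
case: i GE => [[|[|[|[|i]]]] hi] // GE.
- rewrite (GE (fun x => - F x) (fun=> 1) _ _ _ (is_deriveN d) d1)/=.
    by case: m {GE} => [[|[|[|[|m]]]] hm] //=; rewrite ?mulr1 ?mulr0.
  by move=> q; rewrite mulr1.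
- rewrite (GE (fun x => (F x)^-1) (fun=> 1) _ _ _ (is_deriveV f0 d) d1)/=.
    case: m {GE} => [[|[|[|[|m]]]] hm] //=; rewrite ?mulr1 ?mulr0//.
    by rewrite [LHS]mulNr mulrC.
  by move=> q; rewrite mulr1.
- rewrite (GE (fun x => x ^+ 2) (fun=> 1) _ _ _ dx2 d1)/=.
    by case: m {GE} => [[|[|[|[|m]]]] hm] //=; rewrite ?mulr1 ?mulr0.
  by move=> q; rewrite mulr1.
- by rewrite (GE _ (fun x => sin x ^+ 2) _ _ _ dx2 ds2)//;
    case: m {GE} => [[|[|[|[|m]]]] hm].
Qed.

Let chr l i j p := christoffel_entry (F (rho p)) (F1 (rho p)) (rho p)
  (sin (theta p)) (cos (theta p)) l i j.

Lemma static_christoffel l i j p : U p -> christoffel nabla l i j p = chr l i j p.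
Proof.
move=> Up.
rewrite (christoffel_diag oU gE static_coef_neq0 lc l i j Up).
rewrite !partial_static_coef// -!val_eqE.
by apply: christoffel_entryE; rewrite ?ltn_ord ?F0 ?r0 ?s0.
Qed.

Lemma partial_static_christoffel m l i j p : U p ->
  partial m (christoffel nabla l i j) p =
  christoffel_entry_partial (F (rho p)) (F1 (rho p)) (F2 (rho p)) (rho p)
    (sin (theta p)) (cos (theta p)) m l i j.
Proof.
move=> Up; rewrite (partial_ext oU m (fun q => @static_christoffel l i j q) Up).
exact: (partial_rad_ang m Up (is_derive_christoffel_radial l i j Up) (is_derive_christoffel_angular l i j Up)).
Qed.

Definition static_curvature (p : point) (i j : 'I_4) : R :=
  block_curvature (F2 (rho p) / 2) (F1 (rho p) / (2 * rho p))
    ((F (rho p) - 1) / rho p ^+ 2) i j.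

Lemma static_curvature_sym p i j : static_curvature p i j = static_curvature p j i.
Proof.
by case: i => [[|[|[|[|i]]]] hi] //; case: j => [[|[|[|[|j]]]] hj].
Qed.

Lemma static_curvature_diag p i : static_curvature p i i = 0.
Proof. by case: i => [[|[|[|[|i]]]] hi]. Qed.

(** By tensoriality it is enough to compare the components on coordinate
    fields, where both sides are rational functions of the values of F, F', F'',
    rho, sin theta and cos theta. *)
Lemma sectional_static : sectional U G static_curvature (riemann_op nabla).
Proof.
apply: (sectional_riemann oU lc) => [p i j k l Up|p l m _]; last first.
  exact: static_curvature_sym.
rewrite (riemann_op_christoffel oU cn i j k l Up).
rewrite !partial_static_christoffel//.
under eq_bigr do rewrite !static_christoffel//.
rewrite -!val_eqE.
by apply: riemann_entryE; rewrite ?ltn_ord ?F0 ?r0 ?s0.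
Qed.

Section EnergyMomentum.
Variable Lambda : R.
Let T := energy_momentum g nabla Lambda.

Let s_ := ricci_eigenvalue static_curvature.
Let t_ := energy_momentum_eigenvalue static_curvature Lambda.

Let Ksym p l m : U p -> static_curvature p l m = static_curvature p m l.
Proof. by move=> _; exact: static_curvature_sym. Qed.

Let Kdiag p l : U p -> static_curvature p l l = 0.
Proof. by move=> _; exact: static_curvature_diag. Qed.

Let diagT : diagonal_form U G t_ T.
Proof.
exact: (energy_momentum_diag oU gE static_coef_neq0 sectional_static).
Qed.

Let smoothT X Y : smooth_vfield U X -> smooth_vfield U Y ->
  smooth_sfield U (T X Y).
Proof. exact: (smooth_energy_momentum oU gE smooth_static_coef static_coef_neq0 lc). Qed.

Let smooth_weyl : smooth_op U (weyl_op g nabla).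
Proof. exact: (smooth_weyl_op oU gE smooth_static_coef static_coef_neq0 lc). Qed.

Let smooth_riemann : smooth_op U (riemann_op nabla).
Proof. by move=> X Y Z; apply: smooth_riemann_op. Qed.

Let weylK : sectional U G (weyl_eigenvalue static_curvature) (weyl_op g nabla).
Proof. exact: (sectional_weyl oU gE static_coef_neq0 sectional_static). Qed.

Let weyl_sym p l m : U p ->
  weyl_eigenvalue static_curvature p l m = weyl_eigenvalue static_curvature p m l.
Proof. by move=> Up; rewrite /weyl_eigenvalue Ksym// [X in _ * X]addrC. Qed.

(** The trace and cosmological terms are multiples of g, so T distinguishes the
    same directions as the Ricci tensor. *)
Let t_sub p l m : t_ l p - t_ m p = s_ l p - s_ m p.
Proof.
rewrite /t_ /energy_momentum_eigenvalue -!/(s_ _ _).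
by move: (s_ l p) (s_ m p) (_ / 2) => a b c; ring.
Qed.

Lemma static_riemann_pseudosymmetric W Z X Y p :
  smooth_vfield U W -> smooth_vfield U Z -> smooth_vfield U X ->
  smooth_vfield U Y -> U p ->
  tensor_dot (riemann_op nabla) T W Z X Y p =
  F1 (rho p) / (2 * rho p) * tachibana g T W Z X Y p.
Proof.
move=> sW sZ sX sY Up.
apply: (tensor_dot_tachibana oU gE smooth_static_coef sectional_static _ diagT) => //.
move=> l m; rewrite t_sub.
exact: block_ricci_mixed.
Qed.

Lemma static_weyl_pseudosymmetric W Z X Y p :
  smooth_vfield U W -> smooth_vfield U Z -> smooth_vfield U X ->
  smooth_vfield U Y -> U p ->
  tensor_dot (weyl_op g nabla) T W Z X Y p =
  (2 * (F1 (rho p) / (2 * rho p)) - F2 (rho p) / 2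
   - (F (rho p) - 1) / rho p ^+ 2) / 6 * tachibana g T W Z X Y p.
Proof.
move=> sW sZ sX sY Up.
apply: (tensor_dot_tachibana oU gE smooth_static_coef weylK _ diagT) => //.
move=> l m; rewrite t_sub.
exact: block_weyl_mixed.
Qed.

Lemma static_riemann_compatible : compatible U g (riemann_op nabla) T.
Proof.
by apply: (compatible_diag oU gE smooth_static_coef static_coef_neq0 sectional_static diagT).
Qed.

Lemma static_weyl_compatible : compatible U g (weyl_op g nabla) T.
Proof.
by apply: (compatible_diag oU gE smooth_static_coef static_coef_neq0 weylK diagT).
Qed.

End EnergyMomentum.
End StaticMetric.

(** * The Bardeen metric *)

Section BardeenSpacetime.
Variables (R : realType) (M e : R).
Hypothesis he : e != 0.

Local Notation u := (fun x : R => (Num.sqrt (e ^+ 2 + x ^+ 2))^-1).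

Definition bardeen_profile (x : R) : R := 1 - 2 * M * x ^+ 2 * u x ^+ 3.
Definition bardeen_profile' (x : R) : R :=
  - 4 * M * x * u x ^+ 3 + 6 * M * x ^+ 3 * u x ^+ 5.
Definition bardeen_profile'' (x : R) : R :=
  - 4 * M * u x ^+ 3 + 30 * M * x ^+ 2 * u x ^+ 5 - 30 * M * x ^+ 4 * u x ^+ 7.

Lemma radicand_gt0 (x : R) : 0 < e ^+ 2 + x ^+ 2.
Proof. by rewrite ltr_pwDl ?sqr_ge0// lt0r sqr_ge0 sqrf_eq0 he. Qed.

Lemma rho1_gt0 p : 0 < rho1 e p.
Proof. by rewrite sqrtr_gt0 radicand_gt0. Qed.

Let is_derive_sqr (x : R) : is_derive x 1 (fun y => y ^+ 2) (2 * x).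
Proof.
by apply: (is_derive_eq (is_deriveX 2 (is_derive_id x 1)));
  rewrite /GRing.scale/= mulr1.
Qed.

Lemma is_derive_inv_rho1 (x : R) : is_derive x 1 u (- x * u x ^+ 3).
Proof.
have r0 := radicand_gt0 x.
have s0 : Num.sqrt (e ^+ 2 + x ^+ 2) != 0 by rewrite gt_eqF// sqrtr_gt0.
have dr := is_deriveD (is_derive_cst (e ^+ 2) x 1) (is_derive_sqr x).
have ds := @is_derive1_comp R Num.sqrt (fun y => e ^+ 2 + y ^+ 2) x _ _
             (is_derive1_sqrt r0) dr.
have dV := @is_deriveV R (fun y => Num.sqrt (e ^+ 2 + y ^+ 2)) x _ _ s0 ds.
apply: (is_derive_eq dV); rewrite /GRing.scale/= add0r.
by move: (Num.sqrt _) s0 => s s0; field.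
Qed.

(** In terms of u = 1 / rho_1 the profile and its derivatives are polynomials
    in x and u, and u' = - x u^3. *)
Lemma is_derive_monomial a b (x : R) : is_derive x 1 (fun y => y ^+ a * u y ^+ b)
  (a%:R * x ^+ a.-1 * u x ^+ b - b%:R * x ^+ a.+1 * u x ^+ b.-1 * u x ^+ 3).
Proof.
have dX (f : R -> R) d k : is_derive x 1 f d ->
    is_derive x 1 (fun y => f y ^+ k) (k%:R * f x ^+ k.-1 * d).
  by move=> df; have := is_deriveX k df; rewrite exprfctE.
apply: (is_derive_eq (is_deriveM (dX id _ a (is_derive_id x 1))
                                 (dX u _ b (is_derive_inv_rho1 x)))).
rewrite /GRing.scale/= (exprS x a).
by move: (x ^+ a) (x ^+ a.-1) (u x ^+ b.-1) (u x ^+ b) (u x ^+ 3) => *; ring.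
Qed.

Lemma is_derive_scaled_monomial (c : R) a b (x : R) :
  is_derive x 1 (fun y => c * (y ^+ a * u y ^+ b))
  (c * (a%:R * x ^+ a.-1 * u x ^+ b - b%:R * x ^+ a.+1 * u x ^+ b.-1 * u x ^+ 3)).
Proof. exact: (is_deriveZ c (is_derive_monomial a b x)). Qed.

Lemma is_derive_profile (x : R) : is_derive x 1 bardeen_profile (bardeen_profile' x).
Proof.
have -> : bardeen_profile = fun y => 1 - 2 * M * (y ^+ 2 * u y ^+ 3).
  by apply/funext => y; rewrite /bardeen_profile mulrA.
apply: (is_derive_eq (is_deriveB (is_derive_cst (1 : R) x 1)
  (is_derive_scaled_monomial (2 * M) 2 3 x))).
by rewrite /bardeen_profile' /=; move: (u x) => w; ring.
Qed.

Lemma is_derive_profile' (x : R) : is_derive x 1 bardeen_profile' (bardeen_profile'' x).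
Proof.
have -> : bardeen_profile' = fun y =>
    (- 4 * M) * (y ^+ 1 * u y ^+ 3) + 6 * M * (y ^+ 3 * u y ^+ 5).
  by apply/funext => y; rewrite /bardeen_profile' !mulrA expr1.
apply: (is_derive_eq (is_deriveD (is_derive_scaled_monomial (- 4 * M) 1 3 x)
  (is_derive_scaled_monomial (6 * M) 3 5 x))).
by rewrite /bardeen_profile'' /=; move: (u x) => w; ring.
Qed.

Lemma bardeen_fE p : bardeen_f M e p = bardeen_profile (rho p).
Proof. by rewrite /bardeen_f /bardeen_profile exprVn. Qed.

Lemma bardeen_f_neq0 p : bardeen_domain M e p -> bardeen_f M e p != 0.
Proof.
case=> _ _ _; rewrite /bardeen_f subr_eq0 => h; apply: contra h => /eqP h; apply/eqP.
have r3 : rho1 e p ^+ 3 != 0 by rewrite expf_neq0// gt_eqF// rho1_gt0.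
by rewrite (canRL (divfK r3) (esym h)) mul1r.
Qed.

Lemma smooth_bardeen_f : open (bardeen_domain M e) ->
  smooth_sfield (bardeen_domain M e) (fun p => bardeen_profile (rho p)).
Proof.
move=> oU; have sr := smooth_coordinate oU (@Ordinal 4 1 isT).
have s2 := smoothX oU 2 sr.
have sd := smoothD oU (smooth_cst oU (e ^+ 2)) s2.
have ss := smooth_sqrt oU sd (fun p _ => radicand_gt0 (rho p)).
have su : smooth_sfield (bardeen_domain M e) (fun p => u (rho p)).
  by apply: (smoothV oU ss) => p _; rewrite gt_eqF// rho1_gt0.
apply: (smoothB oU (smooth_cst oU 1)).
exact: (smoothM oU (smoothZ oU (2 * M) s2) (smoothX oU 3 su)).
Qed.

Lemma open_bardeen_domain : open (bardeen_domain M e).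
Proof.
have cr : continuous (@rho R) by exact: coord_continuous.
have ct : continuous (@theta R) by exact: coord_continuous.
have cX k : continuous (fun x : R => x ^+ k) by exact: exprn_continuous.
have cs : continuous (fun x : R => Num.sqrt (e ^+ 2 + x ^+ 2)).
  move=> x; apply: continuous_comp; last exact: sqrt_continuous.
  by apply: cvgD; [exact: cvg_cst|exact: cX].
have ch : continuous (fun x : R =>
    Num.sqrt (e ^+ 2 + x ^+ 2) ^+ 3 - 2 * M * x ^+ 2).
  move=> x; apply: cvgB.
    exact: (@continuous_comp _ _ _ _ (fun y : R => y ^+ 3) _ (cs x) (cX 3 _)).
  by apply: cvgM; [exact: cvg_cst|exact: cX].
have -> : bardeen_domain M e =
  (@rho R) @^-1` [set x | 0 < x] `&` ((@theta R) @^-1` [set x | 0 < x] `&`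
  ((@theta R) @^-1` [set x | x < pi] `&`
   (@rho R) @^-1` ((fun x => Num.sqrt (e ^+ 2 + x ^+ 2) ^+ 3 - 2 * M * x ^+ 2)
      @^-1` [set x | x != 0]))).
  apply/seteqP; split => p /=.
    by case=> *; rewrite subr_eq0.
  by case=> ? [? []] *; split => //; rewrite -subr_eq0.
apply: openI; first by apply: open_comp => //; exact: open_gt.
apply: openI; first by apply: open_comp => //; exact: open_gt.
apply: openI; first by apply: open_comp => //; exact: open_lt.
by apply: open_comp => //; apply: open_comp; [move=> x _; exact: ch|exact: open_neq].
Qed.

Lemma bardeen_metricE p : bardeen_metric M e p =
  diag_mx (\row_i metric_entry (bardeen_profile (rho p)) (rho p) (sin (theta p)) i).
Proof.
congr diag_mx; apply/rowP => i; rewrite !mxE bardeen_fE.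
by case: i => [[|[|[|[|i]]]] hi].
Qed.

Lemma bardeen_mixed_curvature p : 0 < rho p ->
  bardeen_profile' (rho p) / (2 * rho p) =
  - (M * (2 * rho1 e p ^+ 2 - 3 * rho p ^+ 2) / rho1 e p ^+ 5).
Proof.
move=> r0; have := rho1_gt0 p; rewrite /bardeen_profile' -/(rho1 e p).
move: (rho1 e p) (rho p) r0 => r1 r r0 r10.
by field; rewrite !gt_eqF.
Qed.

Lemma bardeen_mixed_weyl p : 0 < rho p ->
  (2 * (bardeen_profile' (rho p) / (2 * rho p)) - bardeen_profile'' (rho p) / 2
   - (bardeen_profile (rho p) - 1) / rho p ^+ 2) / 6 =
  - (M * rho p ^+ 2 * (3 * rho1 e p ^+ 2 - 5 * rho p ^+ 2)
     / (2 * rho1 e p ^+ 7)).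
Proof.
move=> r0; have := rho1_gt0 p.
rewrite /bardeen_profile /bardeen_profile' /bardeen_profile'' -/(rho1 e p).
move: (rho1 e p) (rho p) r0 => r1 r r0 r10.
by field; rewrite !gt_eqF.
Qed.

End BardeenSpacetime.

Theorem theorem4p1 (R : realType) (M e Lambda : R) (hM : M != 0) (he : e != 0)
    (nabla : ('rV[R]_4 -> 'rV[R]_4) -> ('rV[R]_4 -> 'rV[R]_4) ->
             ('rV[R]_4 -> 'rV[R]_4))
    (hnabla : levi_civita (bardeen_domain M e) (bardeen_metric M e) nabla) :
  let U := bardeen_domain M e in
  let g := bardeen_metric M e in
  let T := energy_momentum g nabla Lambda in
  let R_ := riemann_op nabla in
  let C_ := weyl_op g nabla in
  [/\ forall W Z X Y, smooth_vfield U W -> smooth_vfield U Z ->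
        smooth_vfield U X -> smooth_vfield U Y -> forall p, U p ->
        tensor_dot R_ T W Z X Y p =
        - (M * (2 * rho1 e p ^+ 2 - 3 * rho p ^+ 2) / rho1 e p ^+ 5)
          * tachibana g T W Z X Y p,
      forall W Z X Y, smooth_vfield U W -> smooth_vfield U Z ->
        smooth_vfield U X -> smooth_vfield U Y -> forall p, U p ->
        tensor_dot C_ T W Z X Y p =
        - (M * rho p ^+ 2 * (3 * rho1 e p ^+ 2 - 5 * rho p ^+ 2)
           / (2 * rho1 e p ^+ 7))
          * tachibana g T W Z X Y p,
      compatible U g R_ T
    & compatible U g C_ T].
Proof.
move=> U g T R_ C_.
have oU : open U := @open_bardeen_domain R M e.
have dF p : U p -> is_derive (rho p) 1 (bardeen_profile M e) _ :=
  fun _ => is_derive_profile M he (rho p).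
have dF1 p : U p -> is_derive (rho p) 1 (bardeen_profile' M e) _ :=
  fun _ => is_derive_profile' M he (rho p).
have sF := smooth_bardeen_f he oU.
have F0 p : U p -> bardeen_profile M e (rho p) != 0.
  by move=> /(bardeen_f_neq0 he); rewrite bardeen_fE.
have r0 p : U p -> rho p != 0 by case=> r0 *; rewrite gt_eqF.
have s0 p : U p -> sin (theta p) != 0.
  by case=> _ t0 tpi _; rewrite gt_eqF// sin_gt0_pi// t0.
have gE := bardeen_metricE M e.
split.
- move=> W Z X Y sW sZ sX sY p Up; rewrite -bardeen_mixed_curvature//; last by case: Up.
  exact: (static_riemann_pseudosymmetric oU dF dF1 sF F0 r0 s0 gE hnabla).
- move=> W Z X Y sW sZ sX sY p Up; rewrite -bardeen_mixed_weyl//; last by case: Up.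
  exact: (static_weyl_pseudosymmetric oU dF dF1 sF F0 r0 s0 gE hnabla).
- exact: (static_riemann_compatible oU dF dF1 sF F0 r0 s0 gE hnabla).
- exact: (static_weyl_compatible oU dF dF1 sF F0 r0 s0 gE hnabla).
Qed.
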